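(* Let $\omega$ be a non-quasianalytic weight function. Then the inclusion $$(\mathcal{O}_{M,\omega}(\mathbb{R}^N),t)\hookrightarrow (\mathcal{O}_{M,\omega}(\mathbb{R}^N),\tau)$$ is continuous, i.e., the topology $\tau$ is coarser than the topology $t$. Moreover, the spaces $(\mathcal{O}_{M,\omega}(\mathbb{R}^N),t)$ and $(\mathcal{O}_{M,\omega}(\mathbb{R}^N),\tau)$ have the same bounded subsets.
   Context: A non-quasianalytic weight function is a continuous increasing function $\omega:[0,\infty)\to[0,\infty)$ such that: $(\alpha)$ there is $K\geq 1$ with $\omega(2t)\leq K(1+\omega(t))$ for all $t\geq 0$; $(\beta)$ $\int_1^\infty \frac{\omega(t)}{1+t^2}\,dt<\infty$; $(\gamma)$ there are $a\in\mathbb{R}$, $b>0$ with $\omega(t)\geq a+b\log(1+t)$ for all $t\geq 0$; $(\delta)$ $\varphi_\omega(t)=\omega(e^t)$ is convex. Standing normalization: $\omega$ vanishes on $[0,1]$. For $x\in\mathbb{R}^N$ put $\omega(x):=\omega(|x|)$ with $|\cdot|$ the Euclidean norm. The Young conjugate is $\varphi^*_\omega(s):=\sup_{t\geq 0}\{st-\varphi_\omega(t)\}\ge 0$, $s\geq 0$; the value $+\infty$ is allowed, with $\exp(-\infty)=0$ and $\exp(+\infty)=+\infty$. Functions are complex-valued, $\mathbb{N}=\{1,2,\dots\}$, $\mathbb{N}_0=\mathbb{N}\cup\{0\}$. $\mathcal{S}_\omega(\mathbb{R}^N)$ is the set of $f\in L^1(\mathbb{R}^N)$ with $f,\hat f\in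 C^\infty(\mathbb{R}^N)$ and $\|\exp(\lambda\omega)\partial^\alpha f\|_\infty<\infty$, $\|\exp(\lambda\omega)\partial^\alpha \hat f\|_\infty<\infty$ for all $\lambda>0$, $\alpha\in\mathbb{N}_0^N$; equivalently (known), the set of $f\in C^\infty(\mathbb{R}^N)$ with $\sup_{\alpha}\sup_{x}\exp\left(-\lambda\varphi^*_\omega(|\alpha|/\lambda)\right)\exp(\mu\omega(x))|\partial^\alpha f(x)|<\infty$ for all $\lambda,\mu>0$. For $m\in\mathbb{N}$, $n\in\mathbb{N}$, $\mathcal{O}^m_{n,\omega}(\mathbb{R}^N)$ is the space of $f\in C^\infty(\mathbb{R}^N)$ with $r_{m,n}(f):=\sup_{\alpha\in\mathbb{N}_0^N}\sup_{x\in\mathbb{R}^N}|\partial^\alpha f(x)|\exp\left(-n\omega(x)-m\varphi^*_\omega(|\alpha|/m)\right)<\infty$, normed by $r_{m,n}$. $\mathcal{O}_{M,\omega}(\mathbb{R}^N):=\bigcap_{m=1}^\infty\bigcup_{n=1}^\infty\mathcal{O}^m_{n,\omega}(\mathbb{R}^N)$. Topology $t$: each $\bigcup_{n=1}^\infty\mathcal{O}^m_{n,\omega}(\mathbb{R}^N)$ carries the locally convex inductive limit topology of the spaces $(\mathcal{O}^m_{n,\omega}(\mathbb{R}^N),r_{m,n})$, $n\in\mathbb{N}$, and $t$ is the projective limit topology over $m\in\mathbb{N}$. Topology $\tau$: the locally convex topology generated by the seminorms $q_{m,g}(f):=\sup_{\alpha\in\mathbb{N}_0^N}\sup_{x\in\mathbb{R}^N}|g(x)||\partial^\alpha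 f(x)|\exp\left(-m\varphi^*_\omega(|\alpha|/m)\right)$, $m\in\mathbb{N}$, $g\in\mathcal{S}_\omega(\mathbb{R}^N)$ (these are finite on $\mathcal{O}_{M,\omega}(\mathbb{R}^N)$). *)

(* Defs.v *)
From HB Require Import structures.
From mathcomp Require Import all_boot all_order all_algebra.
From mathcomp Require Import interval_inference.
From mathcomp Require Import all_classical all_reals all_analysis.
From mathcomp Require Import complex.

Set Implicit Arguments.
Unset Strict Implicit.
Unset Printing Implicit Defensive.

Import Order.TTheory GRing.Theory Num.Theory.
Import numFieldNormedType.Exports ComplexField.Normc.

Local Open Scope classical_set_scope.
Local Open Scope complex_scope.
Local Open Scope ring_scope.

Section weight.
Variable R : realType.

(* "Increasing" is read as nondecreasing, as forced by the normalization;
   only the values on [0, +oo[ are constrained. *)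
Record nqa_weight := NqaWeight {
  weight_fun :> R -> R;
  weight_continuous : {within `[0, +oo[, continuous weight_fun};
  weight_ge0 : forall t, 0 <= t -> 0 <= weight_fun t;
  weight_nondecreasing : forall s t, 0 <= s -> s <= t ->
    weight_fun s <= weight_fun t;
  weight_alpha : exists2 K : R, 1 <= K &
    forall t, 0 <= t -> weight_fun (2 * t) <= K * (1 + weight_fun t);
  weight_beta : (\int[lebesgue_measure]_(t in `[1%R, +oo[)
    (weight_fun t / (1 + t ^+ 2))%:E < +oo)%E;
  weight_gamma : exists a b : R, 0 < b /\
    forall t, 0 <= t -> a + b * ln (1 + t) <= weight_fun t;
  weight_delta : convex_function [set: convex_lmodType R^o]
    (fun t : R => weight_fun (expR t));
  weight_normalized : forall t, 0 <= t <= 1 -> weight_fun t = 0 }.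

Definition young_conj (w : nqa_weight) (s : R) : \bar R :=
  ereal_sup [set (s * t - w (expR t))%:E | t in `[0, +oo[%classic].

End weight.

Section smooth.
Variables (R : realType) (N : nat).
Implicit Types (u : 'rV[R]_N -> R) (f : 'rV[R]_N -> R[i]).

(* The topology of 'rV[R]_N is that of the max norm; the weights are
   evaluated at the Euclidean norm. *)
Definition euclid_norm (x : 'rV[R]_N) : R := Num.sqrt (\sum_i x 0 i ^+ 2).

Definition partial (i : 'I_N) u : 'rV[R]_N -> R :=
  fun x => 'D_(delta_mx 0 i) u x.

Definition partials (s : seq 'I_N) u : 'rV[R]_N -> R := foldr partial u s.

Definition smoothR u : Prop := forall s : seq 'I_N,
  (forall i x, derivable (partials s u) x (delta_mx 0 i)) /\
  continuous (partials s u).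

Definition multi_index : Type := {ffun 'I_N -> nat}.

Definition mi_order (alpha : multi_index) : nat := \sum_i alpha i.

Definition mpartialR (alpha : multi_index) u : 'rV[R]_N -> R :=
  partials (flatten [seq nseq (alpha i) i | i <- enum 'I_N]) u.

Definition smooth f : Prop :=
  smoothR (fun x => complex.Re (f x)) /\ smoothR (fun x => complex.Im (f x)).

Definition mpartial (alpha : multi_index) f : 'rV[R]_N -> R[i] :=
  fun x => mpartialR alpha (fun y => complex.Re (f y)) x
        +i* mpartialR alpha (fun y => complex.Im (f y)) x.

End smooth.

Section tuple_cons.
Context d (T : measurableType d) (n : nat).

Definition tuple_cons (x : T * n.-tuple T) : n.+1.-tuple T :=
  [the n.+1.-tuple T of x.1 :: x.2].

Lemma measurable_tuple_cons : measurable_fun [set: T * n.-tuple T] tuple_cons.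
Proof. exact: measurable_cons measurable_fst measurable_snd. Qed.

End tuple_cons.

Section product_step.
Context (R : realType) d (T : measurableType d) (n : nat).
Variable nu : {sigma_finite_measure set T -> \bar R}.
Variable mu : {sigma_finite_measure set (n.-tuple T) -> \bar R}.

Definition product_step : set (n.+1.-tuple T) -> \bar R :=
  pushforward (nu \x mu)%E (@tuple_cons d T n).

Let measurable_preim A : measurable A -> measurable (@tuple_cons d T n @^-1` A).
Proof. by move=> mA; rewrite -[_ @^-1` _]setTI; exact: measurable_tuple_cons. Qed.

Let product_step0 : product_step set0 = 0%E.
Proof. by rewrite /product_step /pushforward preimage_set0 measure0. Qed.

Let product_step_ge0 A : (0 <= product_step A)%E.
Proof. by rewrite /product_step /pushforward measure_ge0. Qed.

Let product_step_sigma_additive : semi_sigma_additive product_step.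
Proof.
move=> F mF tF mUF; rewrite /product_step /pushforward preimage_bigcup.
apply: measure_semi_sigma_additive.
- by move=> k; exact: measurable_preim.
- apply/trivIsetP => /= i j _ _ ij; rewrite -preimage_setI.
  by move/trivIsetP : tF => /(_ _ _ _ _ ij) ->//; rewrite preimage_set0.
- by rewrite -preimage_bigcup; exact: measurable_preim.
Qed.

HB.instance Definition _ := isMeasure.Build _ _ _
  product_step product_step0 product_step_ge0 product_step_sigma_additive.

Lemma product_step_sigma_finite : sigma_finite setT product_step.
Proof.
have /sigma_finiteP[F [TF ndF Foo]] := sigma_finiteT nu.
have /sigma_finiteP[G [TG ndG Goo]] := sigma_finiteT mu.
pose g (t : n.+1.-tuple T) : T * n.-tuple T := (thead t, [tuple of behead t]).
have Kg : cancel (@tuple_cons d T n) g.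
  by move=> [x t]; rewrite /g theadE; congr pair; exact: val_inj.
have mg : measurable_fun setT g.
  apply: measurable_fun_pair; last exact: measurable_behead.
  exact: measurable_tnth.
exists (fun k => g @^-1` (F k `*` G k)).
  apply/esym; rewrite -subTset => t _; rewrite -preimage_bigcup /=.
  have [i _ Fi] : (\bigcup_i F i) (g t).1 by rewrite -TF.
  have [j _ Gj] : (\bigcup_i G i) (g t).2 by rewrite -TG.
  exists (maxn i j) => //; split.
    by move: Fi; exact/subsetPset/ndF/leq_maxl.
  by move: Gj; exact/subsetPset/ndG/leq_maxr.
move=> k; have [mF Fk] := Foo k; have [mG Gk] := Goo k; split.
  by rewrite -[_ @^-1` _]setTI; apply: mg => //; exact: measurableX.
rewrite /product_step /pushforward.
rewrite (_ : @tuple_cons d T n @^-1` _ = F k `*` G k); last first.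
  by rewrite -comp_preimage (_ : g \o _ = id)//; exact/funext/Kg.
by rewrite product_measure1E// lte_mul_pinfty// ge0_fin_numE.
Qed.

HB.instance Definition _ := @Measure_isSigmaFinite.Build _ _ _ product_step
  product_step_sigma_finite.

End product_step.

(* The n-fold product of Lebesgue measure on R, on n-tuples. *)
Fixpoint lebesgue_tuple (R : realType) n :
    {sigma_finite_measure set (n.-tuple (measurableTypeR R)) -> \bar R} :=
  match n with
  | 0 => dirac [tuple]
  | n'.+1 => product_step lebesgue_measure (lebesgue_tuple R n')
  end.

Section spaces.
Variables (R : realType) (N : nat) (w : nqa_weight R).
Let V := 'rV[R]_N -> R[i].
Implicit Types (f g : V) (m n : nat).

Definition weight_at (x : 'rV[R]_N) : R := w (euclid_norm x).

Definition row_of_tuple (t : N.-tuple (measurableTypeR R)) : 'rV[R]_N :=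
  \row_i tnth t i.

Definition integrableC (h : N.-tuple (measurableTypeR R) -> R[i]) : Prop :=
  (lebesgue_tuple R N).-integrable setT (fun t => (complex.Re (h t))%:E) /\
  (lebesgue_tuple R N).-integrable setT (fun t => (complex.Im (h t))%:E).

Definition integralC (h : N.-tuple (measurableTypeR R) -> R[i]) : R[i] :=
  (\int[lebesgue_tuple R N]_(t in setT) complex.Re (h t))
  +i* (\int[lebesgue_tuple R N]_(t in setT) complex.Im (h t)).

(* Convention: integral of f(x) e^{-i <x, xi>} dx, without normalizing factor. *)
Definition fourier f : V := fun xi =>
  integralC (fun t => let theta := \sum_i tnth t i * xi 0 i in
    f (row_of_tuple t) * (cos theta -i* sin theta)).

Definition weighted_bounded f : Prop :=
  forall (lambda : R) (alpha : multi_index N), 0 < lambda ->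
    exists C : R, forall x,
      expR (lambda * weight_at x) * normc (mpartial alpha f x) <= C.

Definition S_omega : set V := [set f |
  [/\ integrableC (fun t => f (row_of_tuple t)),
      smooth f /\ smooth (fourier f),
      weighted_bounded f & weighted_bounded (fourier f)]].

Definition young_weight m (alpha : multi_index N) : \bar R :=
  (m%:R%:E * young_conj w ((mi_order alpha)%:R / m%:R))%E.

Definition O_norm m n f : \bar R :=
  ereal_sup (range (fun p : multi_index N * 'rV[R]_N =>
    ((normc (mpartial p.1 f p.2))%:E *
     expeR (- (n%:R * weight_at p.2)%:E - young_weight m p.1))%E)).

Definition O_step m n : set V :=
  [set f | smooth f /\ (O_norm m n f < +oo)%E].

Definition O_union m : set V := \bigcup_(n in [set n | (0 < n)%N]) O_step m n.

Definition O_M : set V := \bigcap_(m in [set m | (0 < m)%N]) O_union m.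

Definition q_seminorm m g f : \bar R :=
  ereal_sup (range (fun p : multi_index N * 'rV[R]_N =>
    ((normc (g p.2) * normc (mpartial p.1 f p.2))%:E *
     expeR (- young_weight m p.1))%E)).

End spaces.

Section submodule.
Variables (R : realType) (N : nat).
Let V := 'rV[R]_N -> R[i].
Implicit Types (u v : 'rV[R]_N -> R) (f g : V) (w : nqa_weight R) (m n : nat).

Lemma is_derive_lin (a b : R) u v x (e : 'rV[R]_N) :
  derivable u x e -> derivable v x e ->
  is_derive x e (fun x => a * u x + b * v x) (a * 'D_e u x + b * 'D_e v x).
Proof.
move=> du dv; apply: (@is_deriveD _ _ _ (a \*: u) (b \*: v)).
  exact: (@is_deriveZ _ _ _ u _ _ _ _ (derivableP du)).
exact: (@is_deriveZ _ _ _ v _ _ _ _ (derivableP dv)).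
Qed.

Lemma partials_lin (a b : R) u v s : smoothR u -> smoothR v ->
  partials s (fun x => a * u x + b * v x) =
  (fun x => a * partials s u x + b * partials s v x).
Proof.
move=> su sv; elim: s => //= i s ->; apply/funext => x; rewrite /partial.
have [du _] := su s; have [dv _] := sv s.
exact: (@derive_val _ _ _ _ _ _ _ (is_derive_lin a b (du i x) (dv i x))).
Qed.

Lemma smoothR_lin (a b : R) u v : smoothR u -> smoothR v ->
  smoothR (fun x => a * u x + b * v x).
Proof.
move=> su sv s; rewrite partials_lin//.
have [du cu] := su s; have [dv cv] := sv s; split=> [i x|x].
  exact: (@ex_derive _ _ _ _ _ _ _ (is_derive_lin a b (du i x) (dv i x))).
apply: (@continuousD R R^o _ (fun x => a * partials s u x)
    (fun x => b * partials s v x)).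
  by apply: continuousM; [exact: cst_continuous|exact: cu].
by apply: continuousM; [exact: cst_continuous|exact: cv].
Qed.

Lemma Re_lin (c : R[i]) f g x : complex.Re ((c *: f + g) x) =
  1 * (complex.Re c * complex.Re (f x) + (- complex.Im c) * complex.Im (f x))
  + 1 * complex.Re (g x).
Proof.
rewrite (_ : (c *: f + g) x = c * f x + g x)// !mul1r mulNr.
by case: c (f x) (g x) => [a b] [p q] [r s].
Qed.

Lemma Im_lin (c : R[i]) f g x : complex.Im ((c *: f + g) x) =
  1 * (complex.Re c * complex.Im (f x) + complex.Im c * complex.Re (f x))
  + 1 * complex.Im (g x).
Proof.
rewrite (_ : (c *: f + g) x = c * f x + g x)// !mul1r.
by case: c (f x) (g x) => [a b] [p q] [r s].
Qed.

Lemma smooth_lin (c : R[i]) f g : smooth f -> smooth g -> smooth (c *: f + g).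
Proof.
move=> [fr fi] [gr gi]; split.
  rewrite (funext (Re_lin c f g)).
  by apply: smoothR_lin => //; exact: smoothR_lin.
rewrite (funext (Im_lin c f g)).
by apply: smoothR_lin => //; exact: smoothR_lin.
Qed.

Lemma mpartial_lin (c : R[i]) f g (alpha : multi_index N) x :
  smooth f -> smooth g ->
  mpartial alpha (c *: f + g) x = c * mpartial alpha f x + mpartial alpha g x.
Proof.
move=> [fr fi] [gr gi]; rewrite /mpartial /mpartialR.
rewrite (funext (Re_lin c f g)) (funext (Im_lin c f g)).
rewrite !partials_lin//; do ?exact: smoothR_lin.
by rewrite !mul1r mulNr; case: c.
Qed.

Lemma smooth0 : smooth (0 : V).
Proof.
have s0 : smoothR (fun _ : 'rV[R]_N => 0).
  have p0 s : partials s (fun _ : 'rV[R]_N => 0 : R) = fun=> 0.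
    elim: s => //= i s ->; apply/funext => x; exact: derive_cst.
  move=> s; rewrite p0; split=> [i x|x]; first exact: derivable_cst.
  exact: cst_continuous.
by [].
Qed.

Lemma mpartial0 (alpha : multi_index N) x : mpartial alpha (0 : V) x = 0.
Proof.
have := mpartial_lin (-1) alpha x smooth0 smooth0.
by rewrite scaler0 addr0 mulN1r addNr.
Qed.

Lemma O_norm0 w m n : O_norm w m n (0 : V) = 0%E.
Proof.
apply/eqP; rewrite eq_le; apply/andP; split.
  by apply: ge_ereal_sup => _ [p _ <-]; rewrite mpartial0 normc0 mul0e.
apply: le_ereal_sup_tmp; exists 0%E => //.
exists ([ffun=> 0%N], 0) => //; by rewrite mpartial0 normc0 mul0e.
Qed.

Lemma O_norm_lin w m n (c : R[i]) f g : smooth f -> smooth g ->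
  (O_norm w m n (c *: f + g)%R <=
   (normc c)%:E * O_norm w m n f + O_norm w m n g)%E.
Proof.
move=> sf sg; apply: ge_ereal_sup => _ [p _ <-].
rewrite mpartial_lin//; set W := expeR _.
have W0 : (0 <= W)%E by exact: expeR_ge0.
have n0 (z : R[i]) : 0 <= normc z by case: z => a b; exact: sqrtr_ge0.
apply: (@le_trans _ _ (((normc c * normc (mpartial p.1 f p.2))%:E
  + (normc (mpartial p.1 g p.2))%:E) * W)%E).
  by rewrite lee_wpmul2r// -EFinD lee_fin -normcM le_normcD.
rewrite ge0_muleDl ?lee_fin ?mulr_ge0// EFinM -muleA leeD//.
  by apply: lee_wpmul2l; rewrite ?lee_fin//; apply: ereal_sup_ubound; exists p.
by apply: ereal_sup_ubound; exists p.
Qed.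

Lemma O_norm_le w m n n' f : (n <= n')%N -> (O_norm w m n' f <= O_norm w m n f)%E.
Proof.
move=> nn'; apply: ge_ereal_sup => _ [p _ <-].
apply: le_trans (_ : _ <= (normc (mpartial p.1 f p.2))%:E *
   expeR (- (n%:R * weight_at w p.2)%:E - young_weight w m p.1))%E _; last first.
  by apply: ereal_sup_ubound; exists p.
apply: lee_wpmul2l.
  by rewrite lee_fin; case: mpartial => a b; exact: sqrtr_ge0.
rewrite lee_expeR leeD2r// leeN2 lee_fin ler_wpM2r ?ler_nat//.
exact/weight_ge0/sqrtr_ge0.
Qed.

Lemma O_step_lin w m n (c : R[i]) f g :
  O_step w m n f -> O_step w m n g -> O_step w m n (c *: f + g).
Proof.
move=> [sf rf] [sg rg]; split; first exact: smooth_lin.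
apply: le_lt_trans (O_norm_lin w m n c sf sg) _.
have r0 h : (0 <= O_norm w m n h)%E.
  apply: le_ereal_sup_tmp; eexists; first by exists ([ffun=> 0%N], 0).
  by rewrite mule_ge0 ?expeR_ge0// lee_fin; case: mpartial => *; exact: sqrtr_ge0.
apply: lte_add_pinfty => //; apply: lte_mul_pinfty => //.
by rewrite lee_fin; case: c => *; exact: sqrtr_ge0.
Qed.

Lemma O_step_le w m n n' : (n <= n')%N -> @O_step R N w m n `<=` @O_step R N w m n'.
Proof. by move=> nn' f [sf rf]; split=> //; exact: le_lt_trans (O_norm_le _ _ _ nn') rf. Qed.

Lemma O_union_lin w m (c : R[i]) f g :
  O_union w m f -> O_union w m g -> O_union w m (c *: f + g).
Proof.
move=> [n n0 Of] [n' _ Og]; exists (maxn n n'); first by rewrite /= leq_max n0.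
apply: O_step_lin; first exact: O_step_le (leq_maxl _ _) _ Of.
exact: O_step_le (leq_maxr _ _) _ Og.
Qed.

Lemma O_union0 w m : O_union w m (0 : V).
Proof. by exists 1%N => //; split; [exact: smooth0|rewrite O_norm0]. Qed.

Lemma O_union_submod w m : GRing.submod_closed (mem (@O_union R N w m) : {pred V}).
Proof.
split=> [|c f g]; first exact/mem_set/O_union0.
by move=> /set_mem Of /set_mem Og; exact/mem_set/O_union_lin.
Qed.

Lemma O_M_submod w : GRing.submod_closed (mem (@O_M R N w) : {pred V}).
Proof.
split=> [|c f g]; first by apply/mem_set => m _; exact: O_union0.
move=> /set_mem Of /set_mem Og; apply/mem_set => m m0.
by apply: O_union_lin; [exact: Of|exact: Og].
Qed.

End submodule.

Section carriers.
Variables (R : realType) (N : nat) (w : nqa_weight R).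
Let V := 'rV[R]_N -> R[i].

Definition O_union_pred m : {pred V} := mem (@O_union R N w m).
Definition O_M_pred : {pred V} := mem (@O_M R N w).

HB.instance Definition _ m :=
  GRing.isSubmodClosed.Build _ V (O_union_pred m) (O_union_submod N w m).
HB.instance Definition _ :=
  GRing.isSubmodClosed.Build _ V O_M_pred (O_M_submod N w).

Record O_unionType m := OUnionType {
  O_union_val : V; O_union_valP : O_union_val \in O_union_pred m }.
Record O_MType := OMType { O_M_val : V; O_M_valP : O_M_val \in O_M_pred }.

HB.instance Definition _ m := [isSub for @O_union_val m].
HB.instance Definition _ m := [Choice of O_unionType m by <:].
HB.instance Definition _ m := [SubChoice_isSubLmodule of O_unionType m by <:].
HB.instance Definition _ := [isSub for O_M_val].
HB.instance Definition _ := [Choice of O_MType by <:].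
HB.instance Definition _ := [SubChoice_isSubLmodule of O_MType by <:].

End carriers.

Section locally_convex.

(* The open sets of the translation-invariant topology in which the family B
   is a base of neighbourhoods of 0. *)
Definition translation_open (E : zmodType) (B : set (set E)) : set (set E) :=
  [set U | forall x, U x -> exists2 W, B W & forall z, W z -> U (x + z)].

Lemma translation_openT (E : zmodType) (B : set (set E)) :
  B !=set0 -> translation_open B setT.
Proof. by move=> [W BW] x _; exists W. Qed.

Lemma translation_openI (E : zmodType) (B : set (set E)) :
  setI_closed B -> setI_closed (translation_open B).
Proof.
move=> BI U U' oU oU' x [Ux U'x].
have [W BW WU] := oU x Ux; have [W' BW' WU'] := oU' x U'x.
by exists (W `&` W'); [exact: BI|move=> z [Wz W'z]; split; [exact: WU|exact: WU']].
Qed.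

Lemma translation_open_bigU (E : zmodType) (B : set (set E)) I (f : I -> set E) :
  (forall i, translation_open B (f i)) -> translation_open B (\bigcup_i f i).
Proof.
move=> of_ x [i _ fx]; have [W BW WU] := of_ i x fx.
by exists W => // z Wz; exists i => //; exact: WU.
Qed.

Definition absolutely_convex (K : numDomainType) (E : lmodType K) (U : set E) :=
  forall (a b : K) (x y : E), `|a| + `|b| <= 1 -> U x -> U y ->
    U (a *: x + b *: y).

(* Von Neumann boundedness: B is absorbed by every neighbourhood of 0. *)
Definition vn_bounded (K : numDomainType) (E : preTopologicalLmodType K)
    (B : set E) : Prop :=
  forall U : set E, nbhs (0 : E) U -> exists2 r : K, 0 < r &
    forall c : K, r <= `|c| -> B `<=` [set c *: u | u in U].

End locally_convex.

Section topologies.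
Variables (R : realType) (N : nat) (w : nqa_weight R).
Let V := 'rV[R]_N -> R[i].

(* Base of neighbourhoods of 0 of the finest locally convex topology on the
   union for which the inclusions of all the normed steps are continuous. *)
Definition inductive_nbhs0 m : set (set (O_unionType N w m)) := [set U |
  absolutely_convex U /\ forall n, (0 < n)%N -> exists2 d : R, 0 < d &
    forall f, O_step w m n (val f) -> (O_norm w m n (val f) < d%:E)%E -> U f].

Lemma inductive_nbhs0T m : @inductive_nbhs0 m !=set0.
Proof. by exists setT; split=> // n _; exists 1. Qed.

Lemma inductive_nbhs0I m : setI_closed (@inductive_nbhs0 m).
Proof.
move=> U U' [aU nU] [aU' nU']; split=> [a b x y ab [? ?] [? ?]|n n0].
  by split; [exact: aU|exact: aU'].
have [d d0 dU] := nU n n0; have [d' d'0 dU'] := nU' n n0.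
exists (Num.min d d') => [|f sf]; first by rewrite lt_min d0.
by rewrite EFin_min lt_min => /andP[fd fd']; split; [exact: dU|exact: dU'].
Qed.

HB.instance Definition _ m := isOpenTopological.Build (O_unionType N w m)
  (translation_openT (inductive_nbhs0T m))
  (translation_openI (@inductive_nbhs0I m))
  (@translation_open_bigU _ _).

Lemma O_M_union (f : O_MType N w) m : O_M_val f \in @O_union_pred R N w m.+1.
Proof. by have /set_mem Of := O_M_valP f; apply/mem_set/Of. Qed.

Definition O_M_incl m (f : O_MType N w) : O_unionType N w m.+1 :=
  OUnionType (O_M_union f m).

(* The projective limit over m >= 1; the index m of the family stands for m.+1. *)
Definition O_M_t : Type := sup_topology (fun m : nat =>
  Topological.on (initial_topology (O_M_incl m))).

HB.instance Definition _ := Topological.on O_M_t.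
HB.instance Definition _ := GRing.Lmodule.copy O_M_t (O_MType N w).

Definition tau_nbhs0 : set (set (O_MType N w)) := [set U |
  exists (s : seq (nat * V)) (e : R),
    [/\ forall p, p \in s -> (0 < p.1)%N /\ S_omega w p.2, 0 < e &
     [set f | forall p, p \in s -> (q_seminorm w p.1 p.2 (val f) < e%:E)%E]
       `<=` U]].

Lemma tau_nbhs0T : tau_nbhs0 !=set0.
Proof. by exists setT; exists [::], 1. Qed.

Lemma tau_nbhs0I : setI_closed tau_nbhs0.
Proof.
move=> U U' [s [e [sP e0 sU]]] [s' [e' [sP' e'0 sU']]].
exists (s ++ s'), (Num.min e e'); split=> [p||f ff].
- by rewrite mem_cat => /orP[/sP|/sP'].
- by rewrite lt_min e0.
- split; [apply: sU => p ps|apply: sU' => p ps].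
    have := ff p; rewrite mem_cat ps EFin_min lt_min => /(_ isT).
    by case/andP.
  have := ff p; rewrite mem_cat ps orbT EFin_min lt_min => /(_ isT).
  by case/andP.
Qed.

Definition O_M_tau : Type := O_MType N w.

HB.instance Definition _ := GRing.Lmodule.copy O_M_tau (O_MType N w).
HB.instance Definition _ := isOpenTopological.Build O_M_tau
  (translation_openT tau_nbhs0T)
  (translation_openI tau_nbhs0I)
  (@translation_open_bigU _ _).

End topologies.

(* Main.v *)
Require Import Defs.
From mathcomp Require Import all_boot all_order all_algebra.
From mathcomp Require Import all_classical all_reals all_analysis.
From mathcomp Require Import measurable_realfun complex ring lra.

(* A tau-bounded set B is t-bounded as soon as for every m some norm r_{m,n} is
   bounded on B. Otherwise, for each k there are f_k in B, a multi-index alpha_k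
   and a point x_k with
     |d^alpha_k f_k (x_k)| exp (- kN w(x_k) - m phi^*(|alpha_k|/m)) > 4^{kN},
   and any g in S_omega with |g(x_k)| >= 2^{-kN} exp (- kN w(x_k)) makes q_{m,g}
   unbounded on B. Such a g exists for an arbitrary sequence (x_k): no bump
   function and no sparse subsequence is needed, because w(t) = O(t), so that the
   Gaussian G(t) = exp (- t^2/2) belongs to S_omega. Take the tensor product
   g(x) = prod_i h_i(x_i) of the even functions
     h_i(t) = sum_k c_k (G(t - s_k) + G(t + s_k)),
     s_k = (x_k)_i,  c_k = 2^{-k} exp (- k w(s_k)),
   whose Fourier transforms are G(t) times the real cosine series
   2 sqrt(2 pi) sum_k c_k cos(s_k t); the c_k decay fast enough for all series
   to be differentiated termwise under the weights exp (l w). *)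

Set Implicit Arguments.
Unset Strict Implicit.
Unset Printing Implicit Defensive.

Import Order.TTheory GRing.Theory Num.Theory.
Import numFieldNormedType.Exports ComplexField.Normc.

Local Open Scope classical_set_scope.
Local Open Scope ring_scope.

(** * Functions with decaying derivatives *)

Section decay.
Variable R : realType.
Implicit Types (W f a b : R -> R) (n : nat).

Lemma derivable_derive1 f (x : R) : derivable f x 1 ->
  is_derive x 1 f (derive1 f x).
Proof. by move=> df; apply: DeriveDef; [exact: df|rewrite derive1E]. Qed.

Lemma mean_value f f' (x y : R) : (forall t : R, is_derive t 1 f (f' t)) ->
  exists2 c, `|c - x| <= `|y - x| & f y - f x = f' c * (y - x).
Proof.
move=> df.
have cf (A : set R) : {within A, continuous f}.
  apply: continuous_subspaceT => t.
  by apply/differentiable_continuous/derivable1_diffP; exact: ex_derive.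
have [xy|yx] := leP x y.
  have [c cxy fc] := MVT_segment xy (fun t _ => df t) (cf _).
  exists c => //; move: cxy; rewrite in_itv/= => /andP[xc cy].
  by rewrite !ger0_norm ?subr_ge0// lerD2r.
have [c cyx fc] := MVT_segment (ltW yx) (fun t _ => df t) (cf _).
exists c.
  move: cyx; rewrite in_itv/= => /andP[yc cx].
  by rewrite !ler0_norm ?subr_le0 ?(ltW yx)// lerN2 lerD2r.
by rewrite -opprB fc -mulrN opprB.
Qed.

Lemma lim_series_bound (u M : R ^nat) :
  (forall k, `|u k| <= M k) -> cvgn (series M) ->
  cvgn (series u) /\ `|limn (series u)| <= limn (series M).
Proof.
move=> uM cM; have cu : cvgn [normed series u].
  apply: (series_le_cvg _ _ uM cM) => k //.
  exact: le_trans (uM k).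
split; first exact: normed_cvg.
by apply: le_trans (lim_series_norm cu) _; exact: lim_series_le.
Qed.

Definition sum_fun (u : nat -> R -> R) : R -> R :=
  fun t => limn (series (u ^~ t)).

(** The first-order Taylor remainder of the sum is at most h^2 times the sum of [M], so the
    difference quotients converge directly. One majorant serves the terms, their derivatives and the
    Lipschitz constants of the derivatives. *)
Lemma is_derive_sum_fun (u u' : nat -> R -> R) (M : R ^nat) (t : R) :
  cvgn (series M) -> (forall k x, `|u k x| <= M k) ->
  (forall k x, `|u' k x| <= M k) ->
  (forall k (x : R), is_derive x 1 (u k) (u' k x)) ->
  (forall k x y, `|u' k x - u' k y| <= M k * `|x - y|) ->
  is_derive t 1 (sum_fun u) (sum_fun u' t).
Proof.
move=> cM uM u'M du lip.
have cu x : cvgn (series (u ^~ x)) := (lim_series_bound (uM ^~ x) cM).1.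
have cu' x : cvgn (series (u' ^~ x)) := (lim_series_bound (u'M ^~ x) cM).1.
have bound h : `|sum_fun u (h + t) - sum_fun u t - h * sum_fun u' t|
    <= h ^+ 2 * limn (series M).
  have -> : sum_fun u (h + t) - sum_fun u t - h * sum_fun u' t =
     limn (series (u ^~ (h + t) - u ^~ t - h *: u' ^~ t)).
    have cB := is_cvg_seriesB (cu (h + t)) (cu t).
    have cZ := @is_cvg_seriesZ _ _ h (cu' t).
    rewrite (lim_seriesB cB cZ) (lim_seriesB (cu (h + t)) (cu t)).
    by rewrite (@lim_seriesZ _ _ h (cu' t)).
  have -> : h ^+ 2 * limn (series M) = limn (series (h ^+ 2 *: M)).
    by rewrite lim_seriesZ.
  apply: (lim_series_bound _ _).2; last exact: is_cvg_seriesZ.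
  move=> k; rewrite !fctE.
  (* The k-th remainder becomes h (u'_k(c) - u'_k(t)) with |c - t| <= |h|, and the Lipschitz
     condition bounds it by M_k h^2. *)
  have [c ct ->] := mean_value t (h + t) (du k).
  rewrite addrK in ct *; rewrite [_ *: _]mulrC -mulrBl normrM.
  apply: (@le_trans _ _ (M k * `|c - t| * `|h|)).
    by rewrite ler_wpM2r.
  rewrite [leRHS]mulrC -[h ^+ 2]ger0_norm ?sqr_ge0// normrX expr2 mulrA.
  rewrite ler_wpM2r// ler_wpM2l//.
  exact: le_trans (uM k t).
have cvgd : h^-1 *: ((sum_fun u \o shift t) (h *: 1) - sum_fun u t)
    @[h --> 0^'] --> sum_fun u' t.
  apply/cvgrPdist_le => e e0.
  pose S := limn (series M).
  have S0 : 0 <= S by apply: le_trans (lim_series_bound (uM ^~ t) cM).2.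
  near=> h.
  have h0 : h != 0 by near: h; exact: nbhs_dnbhs_neq.
  (* The added 1 keeps the denominator positive when [S] vanishes. *)
  have he : `|h| <= e / (S + 1).
    near: h; apply: dnbhs0_le; rewrite divr_gt0// ltr_pwDr//.
  rewrite /= [h *: 1]mulr1 distrC.
  have -> : h^-1 *: (sum_fun u (h + t) - sum_fun u t) - sum_fun u' t =
    h^-1 * (sum_fun u (h + t) - sum_fun u t - h * sum_fun u' t).
    by rewrite [RHS]mulrBr mulKf.
  rewrite normrM normfV ler_pdivrMl ?normr_gt0//.
  apply: le_trans (bound h) _.
  rewrite -[h ^+ 2]ger0_norm ?sqr_ge0// normrX expr2 -mulrA ler_wpM2l//.
  apply: (@le_trans _ _ (e / (S + 1) * (S + 1))).
    by rewrite ler_pM// lerDl.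
  by rewrite divfK// gt_eqF// ltr_pwDr.
apply: DeriveDef; first by apply/cvg_ex; eexists; exact: cvgd.
exact: cvg_lim cvgd.
Unshelve. all: by end_near. Qed.

(** The recursion passes from [f] to its derivative, so differentiability is asked only below order
    [n], and the closure rules follow by induction on [n] with [f] general. *)
Fixpoint decays W n f : Prop :=
  (exists C, forall t, W t * `|f t| <= C) /\
  (if n is n'.+1 then (forall t, derivable f t 1) /\ decays W n' (derive1 f) else True).

Lemma decaysW W n m f : (m <= n)%N -> decays W n f -> decays W m f.
Proof.
elim: n m f => [|n IH] [|m] f//= mn [bf]; first by [].
by move=> [df dn]; split => //; split => //; exact: IH.
Qed.

Lemma decaysD W n f g : (forall t, 0 <= W t) ->
  decays W n f -> decays W n g -> decays W n (fun t => f t + g t).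
Proof.
move=> W0; elim: n f g => [|n IH] f g /= [[C fC] f'] [[D gD] g'];
  (split; [exists (C + D) => t; apply: le_trans (lerD (fC t) (gD t));
    by rewrite -mulrDr ler_wpM2l// ler_normD | ]) => //.
case: f' g' => df f' [dg g']; split => [t|]; first exact: derivableD.
suff -> : derive1 (fun t => f t + g t) =
    (fun t => derive1 f t + derive1 g t) by exact: IH.
by apply/funext => t; rewrite !derive1E deriveD.
Qed.

(** Leibniz rule: one factor carries the weight, the other needs only bounded derivatives. *)
Lemma decaysM W n f g : (forall t, 0 <= W t) ->
  decays W n f -> decays (cst 1) n g -> decays W n (fun t => f t * g t).
Proof.
move=> W0; elim: n f g => [|n IH] f g /= nf ng;
  have [[C fC] f'] := nf; have [[D gD] g'] := ng;
  (split; [exists (C * D) => t; rewrite normrM mulrA ler_pM ?mulr_ge0//;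
     by rewrite -[leLHS]mul1r; exact: gD | ]) => //.
case: f' g' => df f' [dg g']; split => [t|]; first exact: derivableM.
suff -> : derive1 (fun t => f t * g t) =
    (fun t => f t * derive1 g t + derive1 f t * g t).
  apply: decaysD => //; apply: IH => //; first exact: (@decaysW _ n.+1).
  exact: (@decaysW _ n.+1).
by apply/funext => t; rewrite !derive1E deriveM// [X in _ + X]mulrC.
Qed.

Lemma decays_dominated W W' c n f : (forall t, W t <= c * W' t) -> 0 <= c ->
  decays W' n f -> decays W n f.
Proof.
move=> WW' c0; elim: n f => [|n IH] f /= [[C fC] f'];
  (split; [exists (c * C) => t; apply: le_trans (_ : c * (W' t * `|f t|) <= _);
    [by rewrite mulrA ler_wpM2r|by rewrite ler_wpM2l] | ]) => //.
by case: f' => df f'; split => //; exact: IH.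
Qed.

Lemma decays_derive1n W f j : (forall n, decays W n f) ->
  forall n, decays W n (derive1n j f).
Proof. by elim: j => // j IH fn n; have [_ []] := IH fn n.+1. Qed.

(** The hypothesis of the Weierstrass test for derivatives up to order [n]: each order has its own
    summable majorant, uniform in [t]. *)
Fixpoint summable_decays W n (u : nat -> R -> R) : Prop :=
  (exists2 M : R ^nat, cvgn (series M) & forall k t, W t * `|u k t| <= M k) /\
  (if n is n'.+1 then (forall k t, derivable (u k) t 1) /\
     summable_decays W n' (fun k => (derive1 (u k))) else True).

(** The two extra orders pay for termwise differentiation, which uses summable bounds on the second
    derivatives as Lipschitz constants of the first. As [W] is at least 1, the weighted majorants
    also serve as unweighted ones. *)
Lemma decays_sum_fun W n u : (forall t, 1 <= W t) ->
  summable_decays W n.+2 u -> decays W n (sum_fun u).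
Proof.
move=> W1.
have W0 t : 0 < W t by exact: lt_le_trans (W1 t).
have bnd (v : nat -> R -> R) M : cvgn (series M) ->
    (forall k t, W t * `|v k t| <= M k) ->
    exists C, forall t, W t * `|sum_fun v t| <= C.
  move=> cM vM; exists (limn (series M)) => t.
  have vM' k : `|v k t| <= ((W t)^-1 *: M) k by rewrite ler_pdivlMl.
  have cM' : cvgn (series ((W t)^-1 *: M)) by exact: is_cvg_seriesZ.
  have [_ le] := lim_series_bound vM' cM'.
  by rewrite lim_seriesZ// ler_pdivlMl in le.
elim: n u => [|n IH] u su.
  by split=> //; have [[M cM uM] _] := su; exact: bnd uM.
have [[M0 cM0 uM0] [du [[M1 cM1 uM1] [ddu [[M2 cM2 uM2] _]]]]] := su.
have le1 (g : R -> R) t C : W t * `|g t| <= C -> `|g t| <= C.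
  by apply: le_trans; rewrite ler_peMl.
have M0_ge0 k : 0 <= M0 k by apply: le_trans (le1 _ _ _ (uM0 k 0)).
have M1_ge0 k : 0 <= M1 k by apply: le_trans (le1 _ _ _ (uM1 k 0)).
have M2_ge0 k : 0 <= M2 k by apply: le_trans (le1 _ _ _ (uM2 k 0)).
have dsum (t : R) : is_derive t 1 (sum_fun u) (sum_fun (fun k => (derive1 (u k))) t).
  (* The sum of the three majorants dominates terms, first and second derivatives at once. *)
  apply: (@is_derive_sum_fun _ _ (M0 + M1 + M2)).
  - by apply: is_cvg_seriesD => //; exact: is_cvg_seriesD.
  - move=> k x; apply: le_trans (le1 _ _ _ (uM0 k x)) _.
    by rewrite !fctE -addrA lerDl addr_ge0.
  - move=> k x; apply: le_trans (le1 _ _ _ (uM1 k x)) _.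
    by rewrite !fctE addrAC lerDr addr_ge0.
  - by move=> k x; exact/derivable_derive1/du.
  - move=> k x y.
    have ddk (z : R) : is_derive z 1 (derive1 (u k)) (derive1 (derive1 (u k)) z).
      exact/derivable_derive1/ddu.
    have [c _ ->] := mean_value y x ddk.
    rewrite normrM ler_wpM2r//; apply: le_trans (le1 _ _ _ (uM2 k c)) _.
    by rewrite !fctE lerDr addr_ge0.
split.
  exact: bnd uM0.
split=> [t|]; first exact: ex_derive.
suff -> : derive1 (sum_fun u) = sum_fun (fun k => (derive1 (u k))).
  by apply: IH; have [_ []] := su.
by apply/funext => t; rewrite derive1E; exact: derive_val.
Qed.

(** The inequality between the weights splits the weight of a translate between its centre and the
    profile [f]; the coefficients only have to compensate [W1] at the centres. *)
Lemma summable_decays_translates W W1 W2 n (c s : R ^nat) f :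
  (forall t x, W t <= W1 x * W2 (t - x)) -> (forall x, 0 <= W1 x) ->
  (forall k, 0 <= c k) ->
  cvgn (series (fun k => c k * W1 (s k))) -> decays W2 n f ->
  summable_decays W n (fun k t => c k * f (t - s k)).
Proof.
move=> WW W10 c0 cc.
have bnd (g : R -> R) (C : R) k t : (forall t, W2 t * `|g t| <= C) ->
    W t * `|c k * g (t - s k)| <= C * (c k * W1 (s k)).
  move=> gC; rewrite normrM (ger0_norm (c0 k)).
  apply: (@le_trans _ _ (c k * (W1 (s k) * (W2 (t - s k) * `|g (t - s k)|)))).
    by rewrite mulrCA ler_wpM2l// mulrA ler_wpM2r.
  by rewrite [leRHS]mulrC -mulrA ler_wpM2l// ler_wpM2l.
have cC C : cvgn (series (C *: (fun k => c k * W1 (s k)))) by exact: is_cvg_seriesZ.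
elim: n f => [|n IH] f [[C fC] f'].
  by split=> //; exists (C *: (fun k => c k * W1 (s k))) => // k t; exact: bnd.
split.
  by exists (C *: (fun k => c k * W1 (s k))) => // k t; exact: bnd.
case: f' => df f'.
have dk k (t : R) :
    is_derive t 1 (fun t => c k * f (t - s k)) (c k * derive1 f (t - s k)).
  apply: (@is_deriveZ _ _ _ (fun t => f (t - s k))).
  have fd : is_derive (t - s k) 1 f ((derive1 f) (t - s k)).
    exact/derivable_derive1/df.
  have ds : is_derive t 1 (fun t => t - s k) 1 by apply: is_derive_eq; rewrite subr0.
  rewrite -[derive1 f _]mulr1.
  exact: (@is_derive1_comp _ f (fun t => t - s k) t _ _ fd ds).
split=> [k t|]; first exact: ex_derive.
suff -> : (fun k => derive1 (fun t => c k * f (t - s k))) =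
    (fun k t => c k * (derive1 f) (t - s k)) by exact: IH.
by apply/funext => k; apply/funext => t; rewrite derive1E; exact: derive_val.
Qed.

(** The free phase closes the family under differentiation: the derivative of a cosine is a cosine
    with phase advanced by pi / 2. Each derivative costs one factor [s k], hence the moment
    condition for all [j]. *)
Lemma summable_decays_cos n (c s : R ^nat) th :
  (forall j, cvgn (series (fun k => `|c k| * `|s k| ^+ j))) ->
  summable_decays (cst 1) n (fun k t => c k * cos (s k * t + th)).
Proof.
elim: n c th => [|n IH] c th cc;
  (split; [exists (fun k => `|c k| * `|s k| ^+ 0) => // k t;
     by rewrite expr0 mul1r mulr1 normrM ler_piMr// cos_max | ]) => //.
have dk k (t : R) : is_derive t 1 (fun t => c k * cos (s k * t + th))
    ((c k * s k) * cos (s k * t + (th + pi / 2))).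
  rewrite addrA cosD cos_pihalf sin_pihalf mulr0 sub0r mulr1 -mulrA.
  apply: (@is_deriveZ _ _ _ (fun t => cos (s k * t + th))).
  have ds : is_derive t 1 (fun t => s k * t + th) (s k).
    by apply: is_derive_eq; rewrite addr0 [_ *: _]mulr1.
  by rewrite mulrC; exact: (is_derive1_comp (is_derive_cos _) ds).
split=> [k t|]; first exact: ex_derive.
suff -> : (fun k => derive1 (fun t => c k * cos (s k * t + th))) =
    (fun k t => (c k * s k) * cos (s k * t + (th + pi / 2))).
  apply: IH => j; have := cc j.+1.
  suff -> : (fun k => `|c k| * `|s k| ^+ j.+1) =
      (fun k => `|c k * s k| * `|s k| ^+ j) by [].
  by apply/funext => k; rewrite normrM exprS mulrA.
by apply/funext => k; apply/funext => t; rewrite derive1E; exact: derive_val.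
Qed.

End decay.

(** * The Gaussian and its Fourier transform *)

Section gauss.
Variable R : realType.
Implicit Types (W f P : R -> R) (n : nat) (a s t x y th : R).
Local Notation mu := (@lebesgue_measure R).

Definition gauss t : R := expR (- t ^+ 2 / 2).

Lemma gauss_ge0 t : 0 <= gauss t. Proof. exact: expR_ge0. Qed.

Lemma gauss0 : gauss 0 = 1.
Proof. by rewrite /gauss expr0n oppr0 mul0r expR0. Qed.

Lemma is_derive_gauss t : is_derive t 1 gauss (- t * gauss t).
Proof.
have ds : is_derive t 1 (fun t => - t ^+ 2 / 2) (- t).
  by apply: trigger_derive; rewrite /GRing.scale /=; field.
rewrite [- t * _]mulrC.
exact: (@is_derive1_comp _ expR (fun t => - t ^+ 2 / 2) t _ _
  (is_derive_expR _) ds).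
Qed.

Lemma exprn_le_expR y n : 0 <= y -> y ^+ n <= n`!%:R * expR y.
Proof.
move=> y0; case: n => [|n].
  by rewrite expr0 fact0 mul1r -expR0 ler_expR.
rewrite mulrC -ler_pdivrMr ?ltr0n ?fact_gt0//.
by apply: le_trans (expR_ge1Dxn n y0); rewrite lerDr.
Qed.

(** The weight uses up half of the exponent of the Gaussian; the other half, exp (- t^2 / 4), beats
    every power. *)
Lemma exprn_gauss_bound n : exists C, forall t,
  expR (t ^+ 2 / 4) * `|t ^+ n * gauss t| <= C.
Proof.
exists (1 + 4 ^+ n * n`!%:R) => t.
rewrite normrM (ger0_norm (gauss_ge0 t)) mulrCA /gauss -expRD.
have -> : t ^+ 2 / 4 + - t ^+ 2 / 2 = - (t ^+ 2 / 4) by field.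
have y0 : 0 <= t ^+ 2 / 4 by rewrite divr_ge0// sqr_ge0.
rewrite expRN ler_pdivrMr ?expR_gt0//.
(* |t|^n <= 1 + t^(2 n) replaces a possibly odd power by a power of y = t^2 / 4. *)
apply: (@le_trans _ _ (1 + (4 * (t ^+ 2 / 4)) ^+ n)).
  rewrite mulrC divfK// normrX -exprM mulnC exprM.
  rewrite -(real_normK (num_real (t ^+ n))) normrX.
  by have := exprn_ge0 n (normr_ge0 t); nra.
rewrite exprMn mulrDl mul1r lerD//.
  by rewrite -[leLHS]expR0 ler_expR.
by rewrite -[leRHS]mulrA ler_wpM2l ?exprn_ge0// exprn_le_expR.
Qed.

(** The powers make the family stable under differentiation: each derivative combines the powers k -
    1 and k + 1. At k = 0 the truncated [k.-1] is harmless because its coefficient is 0. *)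
Lemma decays_exprn_gauss W c n k : 0 <= c ->
  (forall t, W t <= c * expR (t ^+ 2 / 4)) ->
  decays W n (fun t => t ^+ k * gauss t).
Proof.
move=> c0 Wc; apply: (decays_dominated Wc c0) => {W c c0 Wc}.
elim: n k => [|n IH] k; (split; first exact: exprn_gauss_bound) => //.
have dk t : is_derive t 1 (fun t => t ^+ k * gauss t)
   (k%:R * (t ^+ k.-1 * gauss t) + (- 1) * (t ^+ k.+1 * gauss t)).
  have dx : is_derive t 1 (fun t => t ^+ k) (k%:R * t ^+ k.-1).
    have := is_deriveX k (is_derive_id t (1 : R)).
    by rewrite /GRing.scale/= mulr1 exprfctE.
  apply: (@is_derive_eq _ _ _ _ _ _ _ _ (is_deriveM dx (is_derive_gauss t))).
  by rewrite /GRing.scale/= exprS; ring.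
split=> [t|]; first exact: ex_derive.
suff -> : derive1 (fun t => t ^+ k * gauss t) = (fun t =>
    k%:R * (t ^+ k.-1 * gauss t) + (- 1) * (t ^+ k.+1 * gauss t)).
  have e0 t : 0 <= expR (t ^+ 2 / 4) :> R by exact: expR_ge0.
  have cstn b : decays (cst 1) n (fun=> b : R).
    elim: {IH dk} n b => [|n IH] b;
      (split; first by exists `|b| => t; rewrite mul1r) => //.
    split=> // ; suff -> : derive1 (fun=> b : R) = (fun=> 0) by exact: IH.
    by apply/funext => t; rewrite derive1E derive_cst.
  have scale b j : decays (fun t => expR (t ^+ 2 / 4)) n
      (fun t => b * (t ^+ j * gauss t)).
    have -> : (fun t => b * (t ^+ j * gauss t)) = (fun t => (t ^+ j * gauss t) * b).
      by apply/funext => t; rewrite mulrC.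
    by apply: decaysM => //; exact: IH.
  by apply: decaysD => //; exact: scale.
by apply/funext => t; rewrite derive1E; exact: derive_val.
Qed.

Lemma continuous_derive (P p : R -> R) :
  (forall x : R, is_derive x 1 P (p x)) -> continuous P.
Proof.
move=> dP x; apply/differentiable_continuous/derivable1_diffP; exact: ex_derive.
Qed.

Lemma continuous_gauss : continuous gauss.
Proof. exact: continuous_derive is_derive_gauss. Qed.

(** This is sqrt (2 pi), the inverse of the normalizing constant of the standard normal density. *)
Definition gauss_mass : R := (normal_peak 1)^-1.

Lemma normal_funE a (sg : R) : sg != 0 ->
  EFin \o normal_fun a sg = (fun x => ((normal_peak sg)^-1 * normal_pdf a sg x)%:E).
Proof.
move=> s0; apply/funext => z /=; rewrite /normal_pdf (negbTE s0).
by rewrite mulKf// gt_eqF// normal_peak_gt0.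
Qed.

Lemma integrable_normal_fun a (sg : R) : sg != 0 ->
  mu.-integrable setT (EFin \o normal_fun a sg).
Proof.
move=> s0; rewrite normal_funE//.
under eq_fun do rewrite EFinM.
by apply: integrableZl => //; exact: integrable_normal_pdf.
Qed.

Lemma gauss_normal_fun a : normal_fun a 1 = (fun x => gauss (x - a)).
Proof. by apply/funext => x; rewrite /normal_fun /gauss expr1n. Qed.

Lemma integrable_gauss a : mu.-integrable setT (fun x => (gauss (x - a))%:E).
Proof.
rewrite -/(EFin \o (fun x => gauss (x - a))) -gauss_normal_fun.
exact: integrable_normal_fun.
Qed.

Lemma Rintegral_gauss a : \int[mu]_x gauss (x - a) = gauss_mass.
Proof.
rewrite -gauss_normal_fun /Rintegral.
under eq_integral do rewrite -/(comp EFin _ _) normal_funE// EFinM.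
rewrite integralZl//; last exact: integrable_normal_pdf.
by rewrite integral_normal_pdf mule1.
Qed.

(** Fundamental theorem of calculus on [-n, n], then dominated convergence as these intervals
    exhaust the line. *)
Lemma Rintegral_derivative0 P (p : R -> R) : (forall x : R, is_derive x 1 P (p x)) ->
  continuous p -> mu.-integrable setT (EFin \o p) ->
  P n%:R @[n --> \oo] --> 0 -> P (- n%:R) @[n --> \oo] --> 0 ->
  \int[mu]_x p x = 0.
Proof.
move=> dP cp ip Pn PNn.
pose I n : set R := `[- n%:R, n%:R]%classic.
have mp := measurable_int _ ip.
pose pI n : R -> \bar R := (EFin \o p) \_ (I n).
have mpI n : measurable_fun [set: measurableTypeR R] (pI n).
  by apply/measurable_restrict => //; [exact: measurable_itv|exact: measurable_funS mp].
have [_ _] : [/\ mu.-integrable setT (EFin \o p),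
    [sequence \int[mu]_x `|pI n x - (p x)%:E|]_n @ \oo --> 0 &
    [sequence \int[mu]_x pI n x]_n @ \oo --> \int[mu]_x (p x)%:E]%E.
  apply: (@dominated_convergence _ _ _ mu setT measurableT
    pI _ (fun x => `|(p x)%:E|%E)) => //.
  - apply: aeW => x _; apply: cvg_near_cst; near=> n.
    rewrite /pI patchE ifT// inE /I/= in_itv/= -ler_norml.
    by near: n; exact: nbhs_infty_ger.
  - exact: integrable_abse.
  - apply: aeW => x n _; rewrite /pI patchE; case: ifP => //= _.
    by rewrite normr0 lee_fin.
have -> : ([sequence \int[mu]_x pI n x]_n = (fun n => (P n%:R - P (- n%:R))%:E))%E.
  (* At n = 0 the interval is a single point and is treated apart, since the fundamental theorem
     asks for distinct endpoints. *)
  apply/funext => -[|n] /=; rewrite -integral_mkcond.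
    rewrite /I oppr0 subrr /=.
    by rewrite set_itv1 integral_set1.
  have n0 : - n.+1%:R < n.+1%:R :> R by rewrite gtrN// ltr0n.
  rewrite (@continuous_FTC2 _ p P _ _ n0) ?EFinB//.
  - exact: continuous_subspaceT.
  - split=> [x _||].
    + exact: ex_derive.
    + by apply: cvg_at_right_filter; exact: continuous_derive dP _.
    + by apply: cvg_at_left_filter; exact: continuous_derive dP _.
  - by move=> x _; rewrite derive1E; exact: derive_val.
have c0 : (P n%:R - P (- n%:R))%:E @[n --> \oo] --> (0 : R)%:E.
  by apply: cvg_EFin; [exact: nearW|rewrite -[0](subrr 0); exact: cvgB].
by move=> /(cvg_unique _ c0) int0; rewrite /Rintegral -int0.
Unshelve. all: by end_near. Qed.

End gauss.

(** * Integrals of translated Gaussians against cosines, by a real form of the contour shift *)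

Section gauss_fourier.
Variable R : realType.
Implicit Types (n : nat) (a s t x y th : R).
Local Notation mu := (@lebesgue_measure R).

Lemma gauss_small (e : R) : 0 < e -> exists2 M, 0 < M &
  forall y, M <= `|y| -> gauss y <= e.
Proof.
move=> e0; have [C CP] := @exprn_gauss_bound R 1.
have C1 : 0 < `|C| + 1 by rewrite ltr_pwDr.
exists ((`|C| + 1) / e); first by rewrite divr_gt0.
move=> y My; have y0 : 0 < `|y| by apply: lt_le_trans My; rewrite divr_gt0.
rewrite ler_pdivrMr// in My; rewrite -(ler_pM2l y0); apply: le_trans My.
have := CP y; rewrite expr1 normrM (ger0_norm (gauss_ge0 y)) => le.
apply: (@le_trans _ _ C); last by rewrite (le_trans (ler_norm C))// lerDl.
apply: le_trans le; rewrite ler_peMl ?mulr_ge0 ?gauss_ge0//.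
by rewrite -[leLHS]expR0 ler_expR divr_ge0// sqr_ge0.
Qed.

(** Real part of exp (i th - (x - a - i s)^2 / 2). Below, [iwave] is its imaginary part and [dwave]
    the derivative of the real part in [s]. *)
Definition wave a th s x :=
  expR (s ^+ 2 / 2) * (gauss (x - a) * cos ((x - a) * s + th)).

Definition dwave a th s x := expR (s ^+ 2 / 2) *
  (gauss (x - a) * (s * cos ((x - a) * s + th) - (x - a) * sin ((x - a) * s + th))).

Definition iwave a th s x :=
  expR (s ^+ 2 / 2) * (gauss (x - a) * sin ((x - a) * s + th)).

Lemma is_derive_affine (b c x : R) : is_derive x 1 (fun z => b * z + c) b.
Proof. by apply: trigger_derive; rewrite /GRing.scale/= mulr1 addr0. Qed.

Lemma is_derive_waveS a th s x :
  is_derive s 1 (fun s => wave a th s x) (dwave a th s x).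
Proof.
have de : is_derive s 1 (fun s => expR (s ^+ 2 / 2)) (expR (s ^+ 2 / 2) * s).
  have ds : is_derive s 1 (fun s => s ^+ 2 / 2) s.
    by apply: trigger_derive; rewrite /GRing.scale /=; field.
  exact: (@is_derive1_comp _ expR (fun s => s ^+ 2 / 2) s _ _ (is_derive_expR _) ds).
have dc : is_derive s 1 (fun s => cos ((x - a) * s + th))
    (- sin ((x - a) * s + th) * (x - a)).
  exact: (@is_derive1_comp _ cos (fun s => (x - a) * s + th) s _ _ (is_derive_cos _)
    (is_derive_affine _ _ _)).
have dgc : is_derive s 1 (fun s => gauss (x - a) * cos ((x - a) * s + th))
    (gauss (x - a) * (- sin ((x - a) * s + th) * (x - a))).
  exact: (@is_deriveZ _ _ _ (fun s => cos ((x - a) * s + th)) _ _ _ _ dc).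
apply: (@is_derive_eq _ _ _ _ _ _ _ _ (is_deriveM de dgc)).
by rewrite /GRing.scale/= /dwave; ring.
Qed.

(** A Cauchy-Riemann equation: the function that is the [s]-derivative of [wave] is also the
    [x]-derivative of [iwave]. *)
Lemma is_derive_iwave a th s x :
  is_derive x 1 (iwave a th s) (dwave a th s x).
Proof.
have dg : is_derive x 1 (fun x => gauss (x - a)) (- (x - a) * gauss (x - a) * 1).
  have da : is_derive x 1 (fun x => x - a) 1.
    by apply: trigger_derive; rewrite subr0.
  exact: (@is_derive1_comp _ (@gauss R) (fun x => x - a) x _ _ (is_derive_gauss _) da).
have dc : is_derive x 1 (fun x => sin ((x - a) * s + th)) (cos ((x - a) * s + th) * s).
  have da : is_derive x 1 (fun x => (x - a) * s + th) s.
    by apply: trigger_derive; rewrite /GRing.scale/=; ring.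
  exact: (@is_derive1_comp _ sin (fun x => (x - a) * s + th) x _ _ (is_derive_sin _) da).
have := @is_deriveZ _ _ _ _ (expR (s ^+ 2 / 2)) _ _ _ (is_deriveM dg dc).
move=> /(@is_derive_eq _ _ _ _ _ _ _ _); apply.
by rewrite /GRing.scale/= /dwave; ring.
Qed.

Lemma continuous_dwave a th s : continuous (dwave a th s).
Proof.
have cy : continuous (fun x => x - a).
  by move=> x; apply: cvgB; [exact: cvg_id|exact: cvg_cst].
have cs : continuous (fun x => (x - a) * s + th).
  by move=> x; apply: cvgD; [apply: cvgM; [exact: cy|exact: cvg_cst]|exact: cvg_cst].
move=> x; apply: cvgM; first exact: cvg_cst.
apply: cvgM; first exact: (continuous_comp (cy x) (@continuous_gauss R _)).
apply: cvgB; apply: cvgM.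
- exact: cvg_cst.
- exact: (continuous_comp (cs x) (@continuous_cos R _)).
- exact: cy.
- exact: (continuous_comp (cs x) (@continuous_sin R _)).
Qed.

(** The Gaussian of variance 2 keeps half of the exponent of [gauss], which leaves room for linear
    factors; its integrability is that of a normal density. *)
Definition wide_gauss a x := normal_fun a (Num.sqrt 2) x.

Lemma wide_gaussE a x : wide_gauss a x = expR (- (x - a) ^+ 2 / 4).
Proof.
rewrite /wide_gauss /normal_fun sqr_sqrtr//; congr (expR (_ / _)).
by rewrite -mulr_natr -natrM.
Qed.

Lemma integrable_wide_gauss a : mu.-integrable setT (EFin \o wide_gauss a).
Proof. by apply: integrable_normal_fun; rewrite gt_eqF// sqrtr_gt0. Qed.

(** The bound is uniform in |s| <= S, as domination under the integral requires. The Gaussian is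
    split into two equal factors, one of which absorbs x - a. *)
Lemma dwave_bound a th s S x : `|s| <= S ->
  `|dwave a th s x| <= expR (S ^+ 2 / 2) * (S + 1) * wide_gauss a x.
Proof.
move=> sS; have S0 : 0 <= S := le_trans (normr_ge0 s) sS.
rewrite /dwave wide_gaussE normrM ger0_norm ?expR_ge0// -mulrA.
apply: ler_pM; rewrite ?expR_ge0//.
  rewrite ler_expR ler_pM2r ?invr_gt0// -[s ^+ 2]ger0_norm ?sqr_ge0//.
  by rewrite normrX lerXn2r ?nnegrE.
rewrite normrM ger0_norm ?gauss_ge0//; set y := x - a; set u := y * s + th.
have -> : gauss y = expR (- y ^+ 2 / 4) * expR (- y ^+ 2 / 4).
  by rewrite /gauss -expRD; congr expR; field.
rewrite -mulrA [leRHS]mulrC ler_wpM2l ?expR_ge0//.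
have -> : - y ^+ 2 / 4 = - (y ^+ 2 / 4) by rewrite mulNr.
rewrite expRN ler_pdivrMl ?expR_gt0//.
(* From (|y| / 2 - 1)^2 >= 0 one gets |y| <= 1 + y^2 / 4, which is at most the exponential. *)
have y1 : `|y| <= expR (y ^+ 2 / 4).
  apply: le_trans (expR_ge1Dx _); rewrite -(real_normK (num_real y)).
  by have := sqr_ge0 (`|y| / 2 - 1); set z := `|y|; nra.
have e1 : 1 <= expR (y ^+ 2 / 4) by rewrite -[leLHS]expR0 ler_expR divr_ge0// sqr_ge0.
apply: le_trans (ler_normB _ _) _; rewrite !normrM mulrDr mulr1 lerD//.
  rewrite mulrC; apply: ler_pM => //; exact: le_trans (cos_max u) e1.
by apply: le_trans y1; rewrite ler_piMr// sin_max.
Qed.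

Lemma integrable_dwave a th s : mu.-integrable setT (EFin \o dwave a th s).
Proof.
apply: (le_integrable measurableT _ _
  (integrableZl measurableT (expR (`|s| ^+ 2 / 2) * (`|s| + 1))
    (integrable_wide_gauss a))).
  apply/measurable_EFinP.
  by apply: continuous_measurable_fun; exact: continuous_dwave.
move=> x _ /=; rewrite lee_fin; apply: le_trans (ler_norm _).
exact: dwave_bound.
Qed.

Lemma Rintegral_dwave a th s : \int[mu]_x dwave a th s x = 0.
Proof.
have cvg0 (z : nat -> R) : (forall M : R, \forall n \near \oo, M <= `|z n - a|) ->
    iwave a th s (z n) @[n --> \oo] --> (0 : R).
  move=> zoo; apply/cvgrPdist_le => e e0.
  have es0 : 0 < e / expR (s ^+ 2 / 2) by rewrite divr_gt0 ?expR_gt0.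
  have [M M0 gM] := gauss_small es0.
  near=> n; rewrite sub0r normrN /iwave normrM ger0_norm ?expR_ge0//.
  rewrite -ler_pdivlMl ?expR_gt0// [leRHS]mulrC normrM ger0_norm ?gauss_ge0//.
  apply: le_trans (gM (z n - a) _); last by near: n; exact: zoo.
  by rewrite ler_piMr ?gauss_ge0// sin_max.
apply: (@Rintegral_derivative0 _ (iwave a th s)).
- by move=> x; exact: is_derive_iwave.
- exact: continuous_dwave.
- exact: integrable_dwave.
- apply: cvg0 => M; near=> n.
  apply: (@le_trans _ _ (n%:R - `|a|)).
    by rewrite lerBrDr; near: n; exact: nbhs_infty_ger.
  by apply: le_trans (ler_norm _); rewrite lerB// ler_norm.
- apply: cvg0 => M; near=> n.
  apply: (@le_trans _ _ (n%:R - `|a|)).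
    by rewrite lerBrDr; near: n; exact: nbhs_infty_ger.
  rewrite -opprD normrN; apply: le_trans (ler_norm _); rewrite lerD2l.
  by rewrite lerNl -normrN ler_norm.
Unshelve. all: by end_near. Qed.

Lemma continuous_wave a th s : continuous (wave a th s).
Proof.
have cy : continuous (fun x => x - a).
  by move=> x; apply: cvgB; [exact: cvg_id|exact: cvg_cst].
have cs : continuous (fun x => (x - a) * s + th).
  by move=> x; apply: cvgD; [apply: cvgM; [exact: cy|exact: cvg_cst]|exact: cvg_cst].
move=> x; apply: cvgM; first exact: cvg_cst.
apply: cvgM; first exact: (continuous_comp (cy x) (@continuous_gauss R _)).
exact: (continuous_comp (cs x) (@continuous_cos R _)).
Qed.

Lemma integrable_wave a th s : mu.-integrable setT (EFin \o wave a th s).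
Proof.
apply: (le_integrable measurableT _ _
  (integrableZl measurableT (expR (s ^+ 2 / 2)) (integrable_gauss a))).
  apply/measurable_EFinP.
  by apply: continuous_measurable_fun; exact: continuous_wave.
move=> x _ /=; rewrite lee_fin !normrM ler_wpM2l//.
by rewrite ler_piMr// cos_max.
Qed.

(* The shift [x -> x + i s] of the Gaussian: the integral of the wave does not
   depend on [s], as its [s]-derivative is an [x]-derivative. *)
Lemma Rintegral_wave a th s : \int[mu]_x wave a th s x = gauss_mass R * cos th.
Proof.
pose A s := \int[mu]_x wave a th s x.
have dA s0 : is_derive s0 1 A 0.
  (* On the window of radius 1 about [s0], |s| is at most [S], so [G] dominates there. *)
  pose S := `|s0| + 1.
  pose G x := expR (S ^+ 2 / 2) * (S + 1) * wide_gauss a x.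
  have Is0 : [set` `](s0 - 1), (s0 + 1)[] s0.
    by rewrite /= in_itv/= ltrBlDr !ltrDl ltr01.
  have intf x : [set` `](s0 - 1), (s0 + 1)[] x ->
    mu.-integrable setT (EFin \o wave a th x) by move=> _; exact: integrable_wave.
  have der x y : [set` `](s0 - 1), (s0 + 1)[] x -> setT y ->
      derivable ((wave a th)^~ y) x 1.
    by move=> _ _; exact: (@ex_derive _ _ _ _ _ _ _ (is_derive_waveS a th x y)).
  have partialE x y : partial1of2 (wave a th) x y = dwave a th x y.
    by rewrite partial1of2E; exact: (@derive_val _ _ _ _ _ _ _ (is_derive_waveS a th x y)).
  have G0 y : 0 <= G y.
    by rewrite /G mulr_ge0 ?expR_ge0// mulr_ge0 ?expR_ge0// addr_ge0// addr_ge0.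
  have iG : mu.-integrable setT (EFin \o G).
    exact: (integrableZl measurableT _ (integrable_wide_gauss a)).
  have Gub x y : [set` `](s0 - 1), (s0 + 1)[] x -> setT y ->
      `|partial1of2 (wave a th) x y| <= G y.
    rewrite /= in_itv/= => /andP[x1 x2] _; rewrite partialE; apply: dwave_bound.
    rewrite -[x](subrK s0) (le_trans (ler_normD _ _))// addrC lerD2l ler_norml.
    by rewrite lerBrDl ltW//= lerBlDl ltW.
  apply: DeriveDef.
    exact: (derivable_under_integral measurableT Is0 intf der G0 iG Gub).
  rewrite -derive1E.
  rewrite (differentiation_under_integral measurableT Is0 intf der G0 iG Gub).
  under eq_Rintegral do rewrite partialE.
  exact: Rintegral_dwave.
rewrite -/(A s) (is_derive_0_is_cst s 0 dA) /A.
under eq_Rintegral.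
  move=> x _; rewrite /wave expr0n mul0r expR0 mul1r mulr0 add0r.
  over.
by rewrite RintegralZr ?Rintegral_gauss//; exact: integrable_gauss.
Qed.

(** Completing the square: the factor exp (s^2 / 2) of the wave at s = xi is cancelled by
    [gauss xi], and the centre contributes the phase a xi. *)
Lemma gauss_cosE a xi th x : gauss (x - a) * cos (x * xi + th) =
  gauss xi * wave a (a * xi + th) xi x.
Proof.
rewrite /wave mulrA (_ : gauss xi * _ = 1); last first.
  by rewrite /gauss -expRD mulNr addNr expR0.
by rewrite mul1r; congr (_ * cos _); ring.
Qed.

Lemma integrable_gauss_cos a xi th :
  mu.-integrable setT (EFin \o (fun x => gauss (x - a) * cos (x * xi + th))).
Proof.
under eq_fun do rewrite gauss_cosE.
exact: (integrableZl measurableT _ (integrable_wave a _ xi)).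
Qed.

Lemma Rintegral_gauss_cos a xi th :
  \int[mu]_x (gauss (x - a) * cos (x * xi + th)) =
  gauss_mass R * gauss xi * cos (a * xi + th).
Proof.
under eq_Rintegral do rewrite gauss_cosE.
rewrite RintegralZl//; last exact: integrable_wave.
by rewrite Rintegral_wave; ring.
Qed.

End gauss_fourier.

(** * Termwise integration of series of nonnegative functions *)

Section integral_series.
Variable R : realType.
Local Notation mu := (@lebesgue_measure R).

Lemma Rintegral_sum_fun (v : nat -> R -> R) :
  (forall k x, 0 <= v k x) -> (forall k, mu.-integrable setT (EFin \o v k)) ->
  (forall x, cvgn (series (v ^~ x))) ->
  cvgn (series (fun k => \int[mu]_x v k x)) ->
  mu.-integrable setT (EFin \o sum_fun v) /\
  \int[mu]_x sum_fun v x = limn (series (fun k => \int[mu]_x v k x)).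
Proof.
move=> v0 iv cv cI.
have EFin_series (u : R ^nat) : cvgn (series u) ->
    (limn (series u))%:E = (\sum_(k <oo) (u k)%:E)%E.
  move=> cu; rewrite -EFin_lim//; congr (limn _); apply/funext => n /=.
  by rewrite sumEFin.
have vE : EFin \o sum_fun v = (fun x => \sum_(k <oo) (v k x)%:E)%E.
  by apply/funext => x; exact: EFin_series.
have mv k : measurable_fun setT (fun x => (v k x)%:E) := measurable_int _ (iv k).
have v0' k x : setT x -> (0 <= (v k x)%:E)%E by rewrite lee_fin.
have intE : (\int[mu]_x (sum_fun v x)%:E =
    (limn (series (fun k => \int[mu]_x v k x)))%:E)%E.
  transitivity (\int[mu]_x (\sum_(k <oo) (v k x)%:E))%E.
    by apply: eq_integral => x _; exact: (congr1 (@^~ x) vE).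
  rewrite (@integral_nneseries _ _ _ mu setT measurableT _ mv v0') EFin_series//.
  apply: eq_eseriesr => k _; rewrite /Rintegral fineK//.
  exact: integrable_fin_num (iv k).
split; last by rewrite /Rintegral intE.
apply/integrableP; split.
  rewrite vE.
  apply: (@ge0_emeasurable_sum _ _ _ setT (fun k x => (v k x)%:E) xpredT) => //.
  by move=> k x _ _; rewrite lee_fin.
have -> : (fun x => `|(EFin \o sum_fun v) x|)%E = (fun x => (sum_fun v x)%:E).
  apply/funext => x; rewrite gee0_abs// lee_fin.
  apply: limr_ge; first exact: cv.
  by apply: nearW => n; apply: sumr_ge0.
by rewrite intE ltry.
Qed.

End integral_series.

(** * Growth of the weight *)

Section weight_growth.
Variables (R : realType) (w : nqa_weight R).
Local Notation mu := (@lebesgue_measure R).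

(** |x + y| is at most twice the larger modulus, so condition (alpha) applies. *)
Lemma weight_subadditive : exists2 K : R, 0 <= K & forall x y : R,
  w `|x + y| <= K * (1 + w `|x| + w `|y|).
Proof.
have [K K1 wK] := weight_alpha w; exists K; first exact: le_trans K1.
have K0 : 0 <= K by exact: le_trans K1.
have base (x y : R) : `|x| <= `|y| -> w `|x + y| <= K * (1 + w `|x| + w `|y|).
  move=> xy; apply: (@le_trans _ _ (w (2 * `|y|))).
    apply: weight_nondecreasing => //; apply: le_trans (ler_normD _ _) _.
    by rewrite mulr_natl mulr2n lerD2r.
  apply: le_trans (wK _ _) _ => //; rewrite ler_wpM2l// lerD2r lerDl.
  exact: weight_ge0.
move=> x y; have [/base//|/ltW/base] := leP `|x| `|y|.
by rewrite addrC -addrA [w `|y| + _]addrC addrA.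
Qed.

(** By monotonicity the integral in (beta), restricted to [t, 2 t], is at least t w(t) / (1 + 4
    t^2); the full integral [J] bounds it. *)
Lemma weight_linear : exists2 A : R, 0 <= A & forall t, 0 <= t -> w t <= A * t.
Proof.
pose f t := w t / (1 + t ^+ 2).
have w_ge0 := @weight_ge0 _ w.
have f0 t : 1 <= t -> 0 <= f t.
  move=> t1; rewrite divr_ge0 ?addr_ge0 ?sqr_ge0//.
  by apply: w_ge0; exact: le_trans t1.
have mf : measurable_fun (`[1%R, +oo[%classic : set R) f.
  apply: measurable_funM.
    apply: (@measurable_funS _ _ _ _ (`[0%R, +oo[%classic : set R)) => //.
      by apply: subset_itvr; rewrite bnd_simp.
    by apply: subspace_continuous_measurable_fun => //; exact: weight_continuous.
  apply: measurable_funTS; apply: continuous_measurable_fun => t.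
  apply: cvgV; first by rewrite gt_eqF// ltr_pwDl// sqr_ge0.
  by apply: cvgD; [exact: cvg_cst|exact: sqr_continuous].
pose J := (\int[mu]_(t in `[1%R, +oo[) (f t)%:E)%E.
have J0 : (0 <= J)%E.
  by apply: integral_ge0 => t /=; rewrite in_itv/= andbT lee_fin; exact: f0.
have Jfin : J \is a fin_num by rewrite ge0_fin_numE//; exact: weight_beta.
(* The 5 comes from 1 + 4 t^2 <= 5 t^2 for t >= 1; below 1 the weight vanishes. *)
exists (5 * fine J); first by rewrite mulr_ge0// fine_ge0.
move=> t t0; have [t1|t1] := leP t 1.
  by rewrite weight_normalized ?t0// !mulr_ge0// fine_ge0.
have {}t0 : 0 < t by exact: lt_trans t1.
have sub : `[t, 2 * t] `<=` (`[1%R, +oo[%classic : set R).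
  by apply: subset_itv; rewrite bnd_simp// ltW.
have : ((w t / (1 + 4 * t ^+ 2) * t)%:E <= J)%E.
  apply: (@le_trans _ _ (\int[mu]_(x in `[t, (2 * t)%R]) (f x)%:E)%E); last first.
    apply: ge0_subset_integral => //; first exact/measurable_EFinP.
    by move=> x /=; rewrite in_itv/= andbT lee_fin; exact: f0.
  apply: (@le_trans _ _ (\int[mu]_(x in `[t, (2 * t)%R])
      (cst (w t / (1 + 4 * t ^+ 2))%:E) x)%E).
    rewrite integral_cst//= lebesgue_measure_itv/= lte_fin.
    have -> : t < 2 * t by rewrite mulr_natl mulr2n ltrDr.
    rewrite -EFinD -EFinM lee_fin.
    by rewrite (_ : 2 * t - t = t) //; ring.
  apply: ge0_le_integral => //.
  - move=> x _; rewrite lee_fin divr_ge0//; first exact/w_ge0/ltW.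
    by rewrite addr_ge0// mulr_ge0// sqr_ge0.
  - by apply/measurable_EFinP; exact: measurable_funS mf.
  - move=> x /=; rewrite in_itv/= => /andP[tx xt]; rewrite lee_fin.
    have x0 : 0 < x by exact: lt_le_trans tx.
    apply: ler_pM; first exact/w_ge0/ltW.
    + by rewrite invr_ge0 addr_ge0// mulr_ge0// sqr_ge0.
    + by apply: weight_nondecreasing => //; exact: ltW.
    + have d1 : 0 < 1 + x ^+ 2 by rewrite ltr_pwDl// sqr_ge0.
      have d2 : 1 + x ^+ 2 <= 1 + 4 * t ^+ 2 by have := ltW x0; nra.
      by rewrite lef_pV2// posrE; exact: lt_le_trans d2.
rewrite -(fineK Jfin) lee_fin => le.
have d0 : 0 < 1 + 4 * t ^+ 2 by rewrite ltr_pwDl// mulr_ge0// sqr_ge0.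
rewrite mulrAC ler_pdivrMr// in le.
have := fine_ge0 J0; move: (fine J) le => j le j0.
rewrite -(ler_pM2r t0); apply: le_trans le _.
have : 1 + 4 * t ^+ 2 <= 5 * t * t by nra.
by move=> /(ler_wpM2l j0) /=; lra.
Qed.

Definition expw (l t : R) : R := expR (l * w `|t|).

Lemma expw_ge1 l t : 0 <= l -> 1 <= expw l t.
Proof. by move=> l0; rewrite -[leLHS]expR0 ler_expR mulr_ge0// weight_ge0. Qed.

(** Linear growth of the weight together with l A |t| <= (l A)^2 + t^2 / 4: this is what places the
    Gaussian below all the weights. *)
Lemma expw_le_gauss l : 0 <= l -> exists2 c, 0 <= c &
  forall t, expw l t <= c * expR (t ^+ 2 / 4).
Proof.
move=> l0; have [A A0 wA] := weight_linear.
exists (expR ((l * A) ^+ 2)); first exact: expR_ge0.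
move=> t; rewrite -expRD ler_expR.
apply: (@le_trans _ _ (l * (A * `|t|))); first by rewrite ler_wpM2l// wA.
rewrite -(real_normK (num_real t)) mulrA.
by have := sqr_ge0 (`|t| / 2 - l * A); set z := `|t|; set u := l * A; nra.
Qed.

(** Provides the weight inequality for translates. The exponent changes from l to l K, so the
    coefficients have to be summable against every [expw]. *)
Lemma expw_translate l : 0 <= l -> exists C mu', [/\ 0 <= C, 0 <= mu' &
  forall t x, expw l t <= (C * expw mu' x) * expw mu' (t - x)].
Proof.
move=> l0; have [K K0 wK] := weight_subadditive.
exists (expR (l * K)), (l * K); split; rewrite ?expR_ge0 ?mulr_ge0// => t x.
rewrite -!expRD ler_expR -[in leLHS](subrK x t) addrC.
apply: le_trans (ler_wpM2l l0 (wK x (t - x))) _.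
by rewrite le_eqVlt; apply/orP; left; apply/eqP; ring.
Qed.

(** Condition (gamma) bounds ln (1 + |t|) by (w - a) / b, so powers of 1 + |t| are exponentials of
    multiples of the weight. *)
Lemma exprn_le_expw j : exists C mu', [/\ 0 <= C, 0 <= mu' &
  forall t, `|t| ^+ j <= C * expw mu' t].
Proof.
have [a [b [b0 wab]]] := weight_gamma w.
exists (expR (- (j%:R / b * a))), (j%:R / b); split => [||t].
- exact: expR_ge0.
- by rewrite divr_ge0// ltW.
apply: (@le_trans _ _ ((1 + `|t|) ^+ j)).
  by rewrite lerXn2r ?nnegrE ?addr_ge0// lerDr.
rewrite -[1 + _]lnK ?posrE ?ltr_pwDl// -expRM_natl /expw -expRD.
rewrite ler_expR [leRHS]addrC -mulrBr -mulrA.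
rewrite ler_wpM2l// ler_pdivlMl// lerBrDl; exact: wab.
Qed.

Variable s : nat -> R.

Definition coef k : R := expR (- (k%:R * w `|s k|)) / 2 ^+ k.

Lemma coef_ge0 k : 0 <= coef k.
Proof. by rewrite divr_ge0 ?expR_ge0// exprn_ge0. Qed.

(** Once k >= l the exponentials multiply to at most 1 and 2^-k remains, whatever the points [s k];
    the finitely many earlier indices go into the constant [M]. *)
Lemma cvg_series_coef l : cvgn (series (fun k => coef k * expw l (s k))).
Proof.
pose n := (Num.truncn l).+1.
pose M : R := 1 + \sum_(k < n) expR ((l - k%:R) * w `|s k|).
apply: (@series_le_cvg _ _ (geometric M 2^-1)).
- by move=> k; rewrite mulr_ge0 ?coef_ge0 ?expR_ge0.
- move=> k; rewrite /= mulr_ge0 ?exprn_ge0// addr_ge0//.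
  by apply: sumr_ge0 => i _; exact: expR_ge0.
- move=> k /=; rewrite /coef mulrAC -expRD exprVn ler_wpM2r ?invr_ge0 ?exprn_ge0//.
  rewrite -mulNr -mulrDl addrC /M; have [kn|nk] := ltnP k n.
    rewrite (bigD1 (Ordinal kn))//= addrCA lerDl.
    by apply: addr_ge0 => //; apply: sumr_ge0 => i _; exact: expR_ge0.
  apply: ler_wpDr; first by rewrite sumr_ge0// => i _; exact: expR_ge0.
  rewrite -[leRHS]expR0 ler_expR mulr_le0_ge0 ?weight_ge0// subr_le0.
  by apply: le_trans (ltW (truncnS_gt l)) _; rewrite ler_nat.
- by apply: is_cvg_geometric_series; rewrite ger0_norm ?invr_ge0// invf_lt1// ltr1n.
Qed.

Lemma cvg_series_coef_exprn j : cvgn (series (fun k => `|coef k| * `|s k| ^+ j)).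
Proof.
have [C [m [C0 m0 sC]]] := exprn_le_expw j.
apply: (@series_le_cvg _ _ (C *: (fun k => coef k * expw m (s k)))).
- by move=> k; rewrite mulr_ge0// exprn_ge0.
- by move=> k; rewrite mulr_ge0// mulr_ge0 ?coef_ge0 ?expR_ge0.
- move=> k; rewrite ger0_norm ?coef_ge0//.
  by apply: le_trans (ler_wpM2l (coef_ge0 k) (sC _)) _; rewrite mulrCA.
- by apply: is_cvg_seriesZ; exact: cvg_series_coef.
Qed.

End weight_growth.

(** * Rapidly decreasing even functions on the line with prescribed lower bounds *)

Section fourier_pair.
Variables (R : realType) (w : nqa_weight R).
Local Notation mu := (@lebesgue_measure R).

Definition rapid (f : R -> R) := forall l n, 0 <= l -> decays (expw w l) n f.

Definition gauss_train (c s : nat -> R) : R -> R :=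
  sum_fun (fun k t => c k * gauss (t - s k)).

Lemma decays_gauss l n : 0 <= l -> decays (expw w l) n (@gauss R).
Proof.
move=> l0; have [c c0 wc] := expw_le_gauss w l0.
have := decays_exprn_gauss n 0 c0 wc.
by under eq_fun do rewrite expr0 mul1r.
Qed.

Lemma rapid_gauss_train (c s : nat -> R) : (forall k, 0 <= c k) ->
  (forall l, cvgn (series (fun k => c k * expw w l (s k)))) ->
  rapid (gauss_train c s).
Proof.
move=> c0 cc l n l0; have [C [m [C0 m0 tr]]] := expw_translate w l0.
apply: decays_sum_fun; first by move=> t; exact: expw_ge1.
refine (@summable_decays_translates _ (expw w l) (fun x => C * expw w m x)
  (expw w m) n.+2 c s (@gauss R) tr _ c0 _ _).
- by move=> x; rewrite mulr_ge0 ?expR_ge0.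
- have -> : (fun k => c k * (C * expw w m (s k))) = C *: (fun k => c k * expw w m (s k)).
    by apply/funext => k; rewrite fctE [RHS]mulrCA.
  exact: (is_cvg_seriesZ (cc m)).
- exact: decays_gauss.
Qed.

(** Termwise integration is available for nonnegative terms, so the series with factors 1 + cos and
    1 are integrated separately and then subtracted. *)
Lemma gauss_train_fourier (c s : nat -> R) xi th : (forall k, 0 <= c k) ->
  cvgn (series c) ->
  mu.-integrable setT (EFin \o (fun x => gauss_train c s x * cos (x * xi + th))) /\
  \int[mu]_x (gauss_train c s x * cos (x * xi + th)) =
  gauss_mass R * gauss xi * sum_fun (fun k y => c k * cos (s k * y + th)) xi.
Proof.
move=> c0 cc.
have gle1 t : gauss t <= 1 :> R.
  by rewrite -[leRHS]expR0 ler_expR mulNr oppr_le0 divr_ge0// sqr_ge0.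
have cgc z k x : `|c k * (gauss (x - s k) * cos (x * z + th))| <= c k.
  rewrite normrM ger0_norm// ler_piMr// normrM (ger0_norm (gauss_ge0 _)).
  by rewrite mulr_ile1 ?gauss_ge0// cos_max.
have cg k x : `|c k * gauss (x - s k)| <= c k.
  by rewrite normrM ger0_norm// ler_piMr// (ger0_norm (gauss_ge0 _)).
pose v k x := c k * gauss (x - s k).
pose v' k x := c k * (gauss (x - s k) * cos (x * xi + th)).
have cv x : cvgn (series (v ^~ x)) := (lim_series_bound (cg ^~ x) cc).1.
have cv' x : cvgn (series (v' ^~ x)) := (lim_series_bound (cgc xi ^~ x) cc).1.
have iv k : mu.-integrable setT (EFin \o v k).
  exact: (integrableZl measurableT (c k) (integrable_gauss (s k))).
have iv' k : mu.-integrable setT (EFin \o v' k).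
  exact: (integrableZl measurableT (c k) (integrable_gauss_cos (s k) xi th)).
have Iv k : \int[mu]_x v k x = c k * gauss_mass R.
  rewrite RintegralZl//; last exact: integrable_gauss.
  by rewrite Rintegral_gauss.
have Iv' k : \int[mu]_x v' k x =
    c k * (gauss_mass R * gauss xi * cos (s k * xi + th)).
  rewrite RintegralZl//; last exact: integrable_gauss_cos.
  by rewrite Rintegral_gauss_cos.
have cI : cvgn (series (fun k => \int[mu]_x v k x)).
  have : cvgn (series (gauss_mass R *: c)) by exact: is_cvg_seriesZ.
  suff -> : gauss_mass R *: c = (fun k => \int[mu]_x v k x) by [].
  by apply/funext => k; rewrite Iv mulrC.
have ccos : cvgn (series (fun k => c k * cos (s k * xi + th))).
  apply: (lim_series_bound _ cc).1 => k.
  by rewrite normrM ger0_norm// ler_piMr// cos_max.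
have Iv'E : (fun k => \int[mu]_x v' k x) =
    (gauss_mass R * gauss xi) *: (fun k => c k * cos (s k * xi + th)).
  by apply/funext => k; rewrite Iv' fctE [RHS]mulrCA.
have cI' : cvgn (series (fun k => \int[mu]_x v' k x)).
  by rewrite Iv'E; exact: is_cvg_seriesZ.
have v0 k x : 0 <= v k x by rewrite mulr_ge0 ?gauss_ge0.
have [ig intg] := Rintegral_sum_fun v0 iv cv cI.
have vv0 k x : 0 <= (v k + v' k) x.
  rewrite fctE /v /v' -mulrDr mulr_ge0// -{1}[gauss _]mulr1 -mulrDr.
  by rewrite mulr_ge0 ?gauss_ge0// -lerBlDl sub0r cos_geN1.
have ivv k : mu.-integrable setT (EFin \o (v k + v' k)).
  exact: (integrableD measurableT (iv k) (iv' k)).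
have Ivv : (fun k => \int[mu]_x (v k + v' k) x) =
    (fun k => \int[mu]_x v k x) + (fun k => \int[mu]_x v' k x).
  by apply/funext => k; rewrite RintegralD.
have cvv x : cvgn (series ((fun k => v k + v' k) ^~ x)).
  exact: (is_cvg_seriesD (cv x) (cv' x)).
have cIvv : cvgn (series (fun k => \int[mu]_x (v k + v' k) x)).
  by rewrite Ivv; exact: (is_cvg_seriesD cI cI').
have [igg intgg] := Rintegral_sum_fun vv0 ivv cvv cIvv.
have E : (fun x => gauss_train c s x * cos (x * xi + th)) =
    (fun x => sum_fun (fun k => v k + v' k) x - sum_fun v x).
  apply/funext => x.
  have -> : sum_fun (fun k => v k + v' k) x = sum_fun v x + sum_fun v' x.
    exact: (lim_seriesD (cv x) (cv' x)).
  rewrite addrAC subrr add0r.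
  have -> : sum_fun v' x = limn (series (cos (x * xi + th) *: (v ^~ x))).
    congr (limn (series _)); apply/funext => k.
    by rewrite fctE /v' /v mulrA [RHS]mulrC.
  by rewrite (lim_seriesZ _ (cv x)) mulrC.
rewrite E; split; first exact: (integrableB measurableT igg ig).
rewrite RintegralB// intgg intg Ivv (lim_seriesD cI cI') addrAC subrr add0r.
by rewrite Iv'E (lim_seriesZ _ ccos).
Qed.

(** Testing against every phase says at once that the cosine transform of [a] is [b] and that its
    sine transform vanishes, in a form that survives tensor products. *)
Lemma fourier_pair (s : nat -> R) : exists a b : R -> R,
  [/\ forall k, coef w s k <= a (s k), rapid a, rapid b &
   forall xi th,
    mu.-integrable setT (EFin \o (fun x => a x * cos (x * xi + th))) /\
    \int[mu]_x (a x * cos (x * xi + th)) = b xi * cos th].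
Proof.
pose c := coef w s; pose s' k := - s k.
have c0 k : 0 <= c k := coef_ge0 w s k.
have cc l : cvgn (series (fun k => c k * expw w l (s k))) by exact: cvg_series_coef.
have cc' l : cvgn (series (fun k => c k * expw w l (s' k))).
  have -> : (fun k => c k * expw w l (s' k)) = (fun k => c k * expw w l (s k)).
    by apply/funext => k; rewrite /expw /s' normrN.
  exact: cc.
have cs : cvgn (series c).
  have -> : c = (fun k => c k * expw w 0 (s k)).
    by apply/funext => k; rewrite /expw mul0r expR0 mulr1.
  exact: cc.
have W0 l t : 0 <= expw w l t by exact: expR_ge0.
have cgauss z t k : `|c k * gauss (t - z k)| <= c k.
  rewrite normrM ger0_norm// ler_piMr// (ger0_norm (gauss_ge0 _)).
  by rewrite -[leRHS]expR0 ler_expR mulNr oppr_le0 divr_ge0// sqr_ge0.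
have cg0 z t i : 0 <= c i * gauss (t - z i) by rewrite mulr_ge0 ?gauss_ge0.
pose m := gauss_mass R.
exists (fun t => gauss_train c s t + gauss_train c s' t).
exists (fun t => gauss t * sum_fun (fun k y => (2 * m * c k) * cos (s k * y + 0)) t).
split.
- move=> k; apply: ler_wpDr.
    apply: limr_ge; first exact: (lim_series_bound (cgauss s' (s k)) cs).1.
    by apply: nearW => n; exact: sumr_ge0.
  apply: limr_ge; first exact: (lim_series_bound (cgauss s (s k)) cs).1.
  (* From n = k + 1 on, the partial sums contain the k-th term, which at [s k] equals [c k] since
     [gauss 0] is 1. *)
  exists k.+1 => // n /= kn; rewrite /series/= (bigD1_seq k)/= ?iota_uniq//; last first.
    by rewrite mem_index_iota.
  rewrite subrr gauss0 mulr1 lerDl; exact: sumr_ge0.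
- move=> l n l0; apply: decaysD => //; exact: rapid_gauss_train.
- move=> l n l0; apply: decaysM => //; first exact: decays_gauss.
  apply: decays_sum_fun; first by move=> t; rewrite lexx.
  apply: summable_decays_cos => j.
  have -> : (fun k => `|2 * m * c k| * `|s k| ^+ j) =
      `|2 * m| *: (fun k => `|c k| * `|s k| ^+ j).
    by apply/funext => k; rewrite fctE normrM [RHS]mulrA.
  exact: (is_cvg_seriesZ (@cvg_series_coef_exprn _ w s j)).
- move=> xi th.
  have [i1 e1] := gauss_train_fourier s xi th c0 cs.
  have [i2 e2] := gauss_train_fourier s' xi th c0 cs.
  have E : (fun x => (gauss_train c s x + gauss_train c s' x) * cos (x * xi + th)) =
      (fun x => gauss_train c s x * cos (x * xi + th) +
        gauss_train c s' x * cos (x * xi + th)).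
    by apply/funext => x; rewrite mulrDl.
  rewrite E; split; first exact: (integrableD measurableT i1 i2).
  rewrite RintegralD// e1 e2 -mulrDr /sum_fun.
  have ccos z y : cvgn (series (fun k => c k * cos (z k * xi + y))).
    apply: (lim_series_bound _ cs).1 => k.
    by rewrite normrM ger0_norm// ler_piMr// cos_max.
  have <- := lim_seriesD (ccos s th) (ccos s' th).
  (* cos (u + th) + cos (- u + th) = 2 cos u cos th: adding the reflected train removes the sine
     part. *)
  have -> : (fun k => c k * cos (s k * xi + th)) + (fun k => c k * cos (s' k * xi + th)) =
      (2 * cos th) *: (fun k => c k * cos (s k * xi + 0)).
    apply/funext => k; rewrite !fctE /s' mulNr addr0 !cosD cosN sinN.
    by rewrite /GRing.scale/=; ring.
  have -> : (fun k => 2 * m * c k * cos (s k * xi + 0)) =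
      (2 * m) *: (fun k => c k * cos (s k * xi + 0)).
    by apply/funext => k; rewrite fctE [RHS]mulrA.
  rewrite (lim_seriesZ _ (ccos s 0)) (lim_seriesZ _ (ccos s 0)) /GRing.scale/=.
  by rewrite /m; ring.
Qed.

End fourier_pair.

(** * Tensor products *)

Section tensor.
Variables (R : realType) (N : nat).
Implicit Types (a : 'I_N -> R -> R) (x : 'rV[R]_N).

Definition tensor a x : R := \prod_i a i (x 0 i).

Definition derive_coord i a : 'I_N -> R -> R :=
  fun j => if j == i then derive1 (a j) else a j.

(** Along a coordinate direction a single factor varies; the product of the others is the constant
    [c]. *)
Lemma is_derive_tensor a i x : (forall t : R, derivable (a i) t 1) ->
  is_derive x (delta_mx 0 i) (tensor a) (tensor (derive_coord i a) x).
Proof.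
move=> dai.
pose c := \prod_(j < N | j != i) a j (x 0 j).
have tE h : tensor a (h *: delta_mx 0 i + x) = a i (h + x 0 i) * c.
  rewrite /tensor (bigD1 i)//= !mxE !eqxx mulr1; congr (_ * _).
  by apply: eq_bigr => j ji; rewrite !mxE eqxx (negbTE ji) mulr0 add0r.
have dE : tensor (derive_coord i a) x = derive1 (a i) (x 0 i) * c.
  rewrite /tensor (bigD1 i)//= /derive_coord eqxx; congr (_ * _).
  by apply: eq_bigr => j ji; rewrite (negbTE ji).
have cvgd : h^-1 *: ((tensor a \o shift x) (h *: delta_mx 0 i) - tensor a x)
    @[h --> (0 : R)^'] --> tensor (derive_coord i a) x.
  rewrite dE; have t0 : tensor a x = a i (x 0 i) * c.
    by rewrite -[x in LHS]add0r -[X in X + x](scale0r (delta_mx 0 i)) tE add0r.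
  under eq_cvg do rewrite /= tE t0 -mulrBl scalerAl.
  apply: cvgM; last exact: cvg_cst.
  have /cvg_ex[l dl] := dai (x 0 i).
  have <- : l = derive1 (a i) (x 0 i).
    by apply/esym; rewrite derive1E; exact: cvg_lim dl.
  move: dl; under eq_cvg do rewrite /= [_ *: 1]mulr1.
  by [].
apply: DeriveDef; first by apply/cvg_ex; eexists; exact: cvgd.
exact: cvg_lim cvgd.
Qed.

Lemma partials_tensor a (s : seq 'I_N) :
  (forall i n (t : R), derivable (derive1n n (a i)) t 1) ->
  partials s (tensor a) = tensor (fun i => derive1n (count_mem i s) (a i)).
Proof.
move=> da; elim: s => //= i s ->; apply/funext => x.
rewrite /partial.
rewrite (@derive_val _ _ _ _ _ _ _ (is_derive_tensor x (da i (count_mem i s)))).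
congr tensor; apply/funext => j; rewrite /derive_coord eq_sym.
by case: (eqVneq i j).
Qed.

Lemma continuous_tensor a : (forall i, continuous (a i)) -> continuous (tensor a).
Proof.
move=> ca; apply: continuous_big => [|i _ x]; first exact: mul_continuous.
apply: (continuous_comp (f := fun x : 'rV_N => x 0 i)); first exact: coord_continuous.
exact: ca.
Qed.

Lemma smoothR_tensor a : (forall i n (t : R), derivable (derive1n n (a i)) t 1) ->
  smoothR (tensor a).
Proof.
move=> da s; rewrite partials_tensor//; split => [i x|].
  apply: (@ex_derive _ _ _ _ _ _ _ (is_derive_tensor x _)) => t; exact: da.
apply: continuous_tensor => i t.
by apply/differentiable_continuous/derivable1_diffP; exact: da.
Qed.

Lemma smooth_tensor a : (forall i n (t : R), derivable (derive1n n (a i)) t 1) ->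
  smooth (fun x => ((tensor a x)%:C)%C).
Proof. by move=> da; split; [exact: smoothR_tensor|have [_] := @smooth0 R N]. Qed.

(** The counts of [s] are left unrelated to [alpha], because the decay of the factors holds for
    derivatives of every order. *)
Lemma mpartial_tensor a alpha :
  (forall i n (t : R), derivable (derive1n n (a i)) t 1) ->
  exists s : seq 'I_N, forall x, mpartial alpha (fun x => ((tensor a x)%:C)%C) x =
    ((tensor (fun i => derive1n (count_mem i s) (a i)) x)%:C)%C.
Proof.
move=> da; eexists=> x; rewrite /mpartial /mpartialR/= partials_tensor//; congr Complex.
elim: (flatten _) x => //= i s IH x; rewrite /partial (_ : partials s _ = fun=> 0).
  exact: derive_cst.
exact/funext.
Qed.

End tensor.

(** * Weights at the Euclidean norm and decay of tensor products *)

Section euclid.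
Variables (R : realType) (N : nat) (w : nqa_weight R).
Implicit Types x : 'rV[R]_N.

Lemma euclid_norm_ge0 x : 0 <= euclid_norm x. Proof. exact: sqrtr_ge0. Qed.

Lemma le_coord_euclid x i : `|x 0 i| <= euclid_norm x.
Proof.
rewrite -sqrtr_sqr /euclid_norm ler_wsqrtr// (bigD1 i)//= lerDl.
by apply: sumr_ge0 => j _; exact: sqr_ge0.
Qed.

Lemma euclid_norm_le_sum x : euclid_norm x <= \sum_i `|x 0 i|.
Proof.
have S0 (r : seq 'I_N) : 0 <= \sum_(i <- r) `|x 0 i| by exact: sumr_ge0.
rewrite -[leRHS]ger0_norm// -sqrtr_sqr ler_wsqrtr//.
elim: (index_enum _) => [|i r IH]; first by rewrite !big_nil expr0n.
rewrite !big_cons sqrrD addrAC real_normK ?num_real// -addrA lerD2l.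
by apply: le_trans IH _; rewrite lerDl mulrn_wge0// mulr_ge0.
Qed.

(** Quasi-subadditivity is iterated along the list of coordinates; [L] is built by induction on that
    list, hence independently of [x]. *)
Lemma weight_at_le_sum : exists2 L : R, 0 <= L & forall x,
  weight_at w x <= L * (1 + \sum_i w `|x 0 i|).
Proof.
have [K K0 wK] := weight_subadditive w.
have [L L0 wL] : exists2 L : R, 0 <= L & forall x,
    w (\sum_(i <- index_enum 'I_N) `|x 0 i|) <=
      L * (1 + \sum_(i <- index_enum 'I_N) w `|x 0 i|).
  elim: (index_enum _) => [|i r [L L0 IH]].
    by exists 0 => // x; rewrite !big_nil mul0r weight_normalized// lexx ler01.
  exists (K * (1 + L)); first by rewrite mulr_ge0// addr_ge0.
  move=> x; rewrite !big_cons.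
  have S0 : 0 <= \sum_(i <- r) `|x 0 i| by exact: sumr_ge0.
  have W0 : 0 <= \sum_(i <- r) w `|x 0 i| by apply: sumr_ge0 => j _; exact: weight_ge0.
  have w0 : 0 <= w `|x 0 i| by exact: weight_ge0.
  have := wK (`|x 0 i|) (\sum_(i <- r) `|x 0 i|).
  rewrite normr_id (ger0_norm S0) (ger0_norm (addr_ge0 _ S0))// => /le_trans; apply.
  rewrite -mulrA ler_wpM2l//; have := IH x.
  move: (w `|x 0 i|) w0 (\sum_(i <- r) w _) W0 (w _) => p p0 q q0 z; nra.
exists L => // x; apply: le_trans (wL x).
by apply: weight_nondecreasing; [exact: euclid_norm_ge0|exact: euclid_norm_le_sum].
Qed.

(** Bounding the weight by a sum over coordinates turns its exponential into a product, and each
    factor absorbs its own share. *)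
Lemma weighted_bounded_tensor (a : 'I_N -> R -> R) : (forall i, rapid w (a i)) ->
  weighted_bounded w (fun x => ((tensor a x)%:C)%C).
Proof.
move=> ra; have da i n (t : R) : derivable (derive1n n (a i)) t 1.
  by have [_ []] := decays_derive1n n (fun m => ra i 0 m (lexx 0)) 1.
move=> l alpha l0.
have [L L0 wL] := weight_at_le_sum.
have lL : 0 <= l * L by rewrite mulr_ge0// ltW.
have [s sE] := mpartial_tensor alpha da.
pose b i := derive1n (count_mem i s) (a i).
have /choice[C CP] i : exists C, forall t, expw w (l * L) t * `|b i t| <= C.
  by have [] := decays_derive1n (count_mem i s) (fun m => ra i (l * L) m lL) 0.
exists (expR (l * L) * \prod_i C i) => x; rewrite sE.
have -> : normc ((tensor b x)%:C)%C = \prod_i `|b i (x 0 i)|.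
  by rewrite /= expr0n addr0 sqrtr_sqr /tensor normr_prod.
apply: (@le_trans _ _ (expR (l * L) *
    \prod_i (expw w (l * L) (x 0 i) * `|b i (x 0 i)|))).
  rewrite big_split/= mulrA ler_wpM2r//; first exact: prodr_ge0.
  rewrite /expw -expR_sum -expRD ler_expR -mulr_sumr -[X in X + _]mulr1 -mulrDr -mulrA.
  by rewrite ler_wpM2l// ltW.
rewrite ler_wpM2l ?expR_ge0//; apply: ler_prod => i _.
by rewrite mulr_ge0 ?expR_ge0//=.
Qed.

End euclid.

(** * Fourier transforms of tensor products, by induction on the dimension *)

Section fourier_tensor.
Variable R : realType.
Local Notation mu := (@lebesgue_measure R).
Local Notation mT := (measurableTypeR R).

Lemma integrable_prod_fun d d' (X : measurableType d) (Y : measurableType d')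
    (m1 : {sigma_finite_measure set X -> \bar R})
    (m2 : {sigma_finite_measure set Y -> \bar R}) (f : X -> R) (g : Y -> R) :
  m1.-integrable setT (EFin \o f) -> m2.-integrable setT (EFin \o g) ->
  (m1 \x m2)%E.-integrable setT (fun z => (f z.1 * g z.2)%:E) /\
  (\int[m1 \x m2]_z (f z.1 * g z.2)%:E =
   (\int[m1]_x (f x)%:E) * (\int[m2]_y (g y)%:E))%E.
Proof.
move=> fi gi.
have /integrableP[mf foo] := fi; have /integrableP[mg goo] := gi.
have mfg : measurable_fun setT (fun z : X * Y => (f z.1 * g z.2)%:E).
  apply/measurable_EFinP; apply: measurable_funM.
    by apply: (measurableT_comp (f := f)) => //; exact/measurable_EFinP.
  by apply: (measurableT_comp (f := g)) => //; exact/measurable_EFinP.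
have gfin := integrable_fin_num measurableT gi.
have mabs d0 (Z : measurableType d0) (h : Z -> R) : measurable_fun setT (EFin \o h) ->
    measurable_fun setT (fun z => `|h z|%:E).
  move=> mh; apply/measurable_EFinP; apply: measurableT_comp; first exact: normr_measurable.
  exact/measurable_EFinP.
have ifg : (m1 \x m2)%E.-integrable setT (fun z => (f z.1 * g z.2)%:E).
  apply/integrable12ltyP => //=.
  under eq_integral.
    move=> x _; under eq_integral do rewrite normrM EFinM.
    rewrite ge0_integralZl//; last exact: mabs.
    over.
  rewrite ge0_integralZr//; last 2 first.
    exact: mabs.
    exact: integral_ge0.
  by rewrite lte_mul_pinfty//; [exact: integral_ge0|
    rewrite ge0_fin_numE//; exact: integral_ge0].
split=> //; rewrite -(integral12_prod_meas1 ifg) /fubini_F/=.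
under eq_integral do under eq_integral do rewrite EFinM.
under eq_integral do rewrite integralZl//.
by rewrite -(fineK gfin) integralZr.
Qed.

(** Fubini for one step of the product measure, transported along [tuple_cons]. *)
Lemma lebesgue_tupleS n (f : R -> R) (g : n.-tuple mT -> R) :
  mu.-integrable setT (EFin \o f) ->
  (lebesgue_tuple R n).-integrable setT (EFin \o g) ->
  let F := fun t : n.+1.-tuple mT => f (thead t) * g [tuple of behead t] in
  (lebesgue_tuple R n.+1).-integrable setT (EFin \o F) /\
  \int[lebesgue_tuple R n.+1]_t F t = \int[mu]_x f x * \int[lebesgue_tuple R n]_t g t.
Proof.
move=> fi gi F.
have /integrableP[mf _] := fi; have /integrableP[mg _] := gi.
have mF : measurable_fun setT (EFin \o F).
  apply/measurable_EFinP; apply: measurable_funM.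
    apply: (measurableT_comp (f := f)); first exact/measurable_EFinP.
    exact: measurable_tnth.
  apply: (measurableT_comp (f := g)); first exact/measurable_EFinP.
  exact: measurable_behead.
have [ifg intfg] := integrable_prod_fun fi gi.
have FE : (EFin \o F) \o @tuple_cons _ mT n = (fun z => (f z.1 * g z.2)%:E).
  apply/funext => -[x t] /=; rewrite /F /tuple_cons/= theadE.
  by congr ((_ * g _)%:E); exact: val_inj.
have mtc := @measurable_tuple_cons _ mT n.
have iF : (mu \x lebesgue_tuple R n)%E.-integrable (@tuple_cons _ mT n @^-1` setT)
    ((EFin \o F) \o @tuple_cons _ mT n).
  by rewrite preimage_setT FE.
split; first exact: (integrable_pushforward mtc mF iF measurableT).
rewrite /Rintegral.
have -> : (\int[lebesgue_tuple R n.+1]_t (F t)%:E)%E =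
    (\int[mu \x lebesgue_tuple R n]_z (f z.1 * g z.2)%:E)%E.
  by rewrite [LHS](integral_pushforward mtc mF iF measurableT) preimage_setT FE.
by rewrite intfg fineM//; [exact: (integrable_fin_num measurableT fi)|
  exact: (integrable_fin_num measurableT gi)].
Qed.

(** The free phase carries the induction: the addition formula splits off the first coordinate as
    cos cos - sin sin, sines being cosines with phase - pi / 2. The integral of the second product
    vanishes because cos (- pi / 2) = 0. *)
Lemma fourier_tensor_tuple n (a : 'I_n -> R -> R) (xi B : 'I_n -> R) :
  (forall i th, mu.-integrable setT (EFin \o (fun x => a i x * cos (x * xi i + th))) /\
     \int[mu]_x (a i x * cos (x * xi i + th)) = B i * cos th) ->
  forall th, (lebesgue_tuple R n).-integrable setT
      (EFin \o (fun t => (\prod_i a i (tnth t i)) *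
        cos (\sum_i tnth t i * xi i + th))) /\
    \int[lebesgue_tuple R n]_t
      ((\prod_i a i (tnth t i)) * cos (\sum_i tnth t i * xi i + th)) =
    (\prod_i B i) * cos th.
Proof.
elim: n a xi B => [|n IH] a xi B aB th.
  have cstE (t : 0.-tuple mT) : (\prod_i a i (tnth t i)) *
      cos (\sum_i tnth t i * xi i + th) = cos th.
    by rewrite !big_ord0 mul1r add0r.
  have E (c : R) : (\int[lebesgue_tuple R 0]_t (cst c%:E) t = c%:E)%E.
    by rewrite integral_cst//= diracT mule1.
  split; last first.
    by under eq_Rintegral do rewrite cstE; rewrite big_ord0 mul1r /Rintegral E.
  rewrite (_ : EFin \o _ = cst (cos th)%:E); last first.
    by apply/funext => t /=; rewrite cstE.
  apply/integrableP; split; first exact: measurable_cst.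
  under eq_integral do rewrite /=.
  by rewrite (E `|cos th|) ltry.
pose a' i := a (lift ord0 i); pose xi' i := xi (lift ord0 i).
pose B' i := B (lift ord0 i).
have {}IH := IH a' xi' B' (fun i => aB (lift ord0 i)).
pose G ph (t : n.-tuple mT) := (\prod_i a' i (tnth t i)) *
  cos (\sum_i tnth t i * xi' i + ph).
pose f ph x := a ord0 x * cos (x * xi ord0 + ph).
have [i1 e1] := lebesgue_tupleS (aB ord0 0).1 (IH th).1.
have [i2 e2] := lebesgue_tupleS (aB ord0 (- (pi / 2))).1 (IH (th - pi / 2)).1.
set F1 := (fun t : n.+1.-tuple mT => _) in i1 e1.
set F2 := (fun t : n.+1.-tuple mT => _) in i2 e2.
have E : (fun t : n.+1.-tuple mT => (\prod_i a i (tnth t i)) *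
    cos (\sum_i tnth t i * xi i + th)) = (fun t => F1 t - F2 t).
  apply/funext => t; rewrite !big_ord_recl /F1 /F2 /= {F1 F2 i1 i2 e1 e2}.
  case/tupleP: t => x t; rewrite theadE tnth0.
  have -> : [tuple of behead [tuple of x :: t]] = t by exact: val_inj.
  have -> : \prod_(i < n) a (lift ord0 i) (tnth [tuple of x :: t] (lift ord0 i)) =
      \prod_(i < n) a' i (tnth t i) by apply: eq_bigr => i _; rewrite tnthS.
  have -> : \sum_(i < n) tnth [tuple of x :: t] (lift ord0 i) * xi (lift ord0 i) =
      \sum_(i < n) tnth t i * xi' i by apply: eq_bigr => i _; rewrite tnthS.
  set S := \sum_(i < n) _; rewrite -addrA cosD addr0 addrA.
  have cosS u : cos (u - pi / 2) = sin u :> R.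
    by rewrite cosB cos_pihalf sin_pihalf mulr0 add0r mulr1.
  by rewrite !cosS; ring.
rewrite E; split; first exact: (integrableB measurableT i1 i2).
rewrite RintegralB// e1 e2 (aB ord0 0).2 (aB ord0 _).2 (IH _).2.
by rewrite cosN cos_pihalf cos0 big_ord_recl; ring.
Qed.

End fourier_tensor.

(** * Elements of [S_omega] bounded below along a sequence *)

Section s_omega.
Variables (R : realType) (N : nat) (w : nqa_weight R).
Local Notation mu := (@lebesgue_measure R).

(** Phases 0 and pi / 2 give the real and imaginary parts of the transform, the latter being 0. The
    transform is thus again a tensor product of rapid functions, to which the same smoothness and
    decay results apply. *)
Lemma tensor_S_omega (a b : 'I_N -> R -> R) :
  (forall i, rapid w (a i)) -> (forall i, rapid w (b i)) ->
  (forall i xi th, mu.-integrable setT (EFin \o (fun x => a i x * cos (x * xi + th))) /\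
     \int[mu]_x (a i x * cos (x * xi + th)) = b i xi * cos th) ->
  S_omega w (fun x => ((tensor a x)%:C)%C).
Proof.
move=> ra rb ab.
have der c (rc : forall i, rapid w (c i)) i n (t : R) : derivable (derive1n n (c i)) t 1.
  by have [_ []] := decays_derive1n n (fun m => rc i 0 m (lexx 0)) 1.
have FT (xi : 'I_N -> R) := @fourier_tensor_tuple R N a xi (fun i => b i (xi i))
  (fun i => ab i (xi i)).
have rowE (t : N.-tuple (measurableTypeR R)) :
    tensor a (row_of_tuple t) = \prod_i a i (tnth t i).
  by apply: eq_bigr => i _; rewrite mxE.
have fourierE : fourier (fun x => ((tensor a x)%:C)%C) = (fun x => ((tensor b x)%:C)%C).
  apply/funext => xi; rewrite /fourier /integralC; congr Complex.
    have := (FT (xi 0) 0).2; rewrite cos0 mulr1 -/(tensor b xi) => <-.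
    by apply: eq_Rintegral => t _ /=; rewrite mul0r subr0 rowE addr0.
  have e := (FT (xi 0) (pi / 2)).2; rewrite cos_pihalf mulr0 in e; rewrite -[RHS]e.
  apply: eq_Rintegral => t _ /=; rewrite mul0r addr0 rowE.
  by rewrite cosD cos_pihalf sin_pihalf mulr0 sub0r mulr1.
split.
- split; last exact: integrable0.
  (* At frequency 0 and phase 0 the cosine is 1, which leaves the integrability of the tensor
     product itself. *)
  have := (FT (fun=> 0) 0).1; congr (integrable _ _ _); apply/funext => t /=.
  rewrite rowE [X in cos (X + _)]big1 => [|i _]; last by rewrite mulr0.
  by rewrite addr0 cos0 mulr1.
- by rewrite fourierE; split; apply: smooth_tensor; exact: der.
- exact: weighted_bounded_tensor.
- by rewrite fourierE; exact: weighted_bounded_tensor.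
Qed.

(** Each of the [N] factors is at least [coef] at a coordinate, and coordinates do not exceed the
    Euclidean norm; multiplying [N] such bounds produces the exponent N k. *)
Lemma S_omega_minorant (x : nat -> 'rV[R]_N) :
  exists2 g : 'rV[R]_N -> R[i], S_omega w g &
    forall k, expR (- ((N * k)%:R * weight_at w (x k))) / 2 ^+ (N * k)
      <= normc (g (x k)).
Proof.
have /choice[a /choice[b ab]] i := fourier_pair w (fun k => x k 0 i).
exists (fun y => ((tensor a y)%:C)%C).
  by apply: (@tensor_S_omega a b) => i; have [] := ab i.
move=> k; rewrite /= expr0n addr0 sqrtr_sqr; apply: le_trans (ler_norm _).
apply: (@le_trans _ _ (\prod_(i < N) (expR (- (k%:R * weight_at w (x k))) / 2 ^+ k))).
  rewrite prodr_const card_ord expr_div_n -exprM -expRM_natl mulnC natrM.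
  by rewrite mulrN mulrA [k%:R * _]mulrC.
apply: ler_prod => i _; rewrite divr_ge0 ?expR_ge0 ?exprn_ge0//=.
have [+ _ _ _] := ab i => /(_ k); apply: le_trans.
rewrite /coef ler_wpM2r ?invr_ge0 ?exprn_ge0// ler_expR lerN2 ler_wpM2l//.
by apply: weight_nondecreasing => //; exact: le_coord_euclid.
Qed.

End s_omega.

(** * The two topologies *)

Section topologies.
Variables (R : realType) (N : nat) (w : nqa_weight R).
Let V := 'rV[R]_N -> R[i].

Lemma normc_ge0 (z : R[i]) : 0 <= normc z.
Proof. by case: z => a b; exact: sqrtr_ge0. Qed.

Lemma q_seminorm_lin m g (c : R[i]) (f h : V) : smooth f -> smooth h ->
  (q_seminorm w m g (c *: f + h)%R <=
   (normc c)%:E * q_seminorm w m g f + q_seminorm w m g h)%E.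
Proof.
move=> sf sg; apply: ge_ereal_sup => _ [p _ <-].
rewrite mpartial_lin//; set W := expeR _.
have W0 : (0 <= W)%E by exact: expeR_ge0.
apply: (@le_trans _ _ (((normc c * (normc (g p.2) * normc (mpartial p.1 f p.2)))%:E
  + (normc (g p.2) * normc (mpartial p.1 h p.2))%:E) * W)%E).
  rewrite lee_wpmul2r// -EFinD lee_fin [normc c * _]mulrCA -mulrDr.
  by rewrite ler_wpM2l ?normc_ge0// (le_trans (le_normcD _ _))// normcM.
rewrite ge0_muleDl ?lee_fin ?mulr_ge0 ?normc_ge0// EFinM -muleA leeD//.
  apply: lee_wpmul2l; rewrite ?lee_fin ?normc_ge0//.
  by apply: ereal_sup_ubound; exists p.
by apply: ereal_sup_ubound; exists p.
Qed.

Lemma q_seminorm_ge0 m g (f : V) : (0 <= q_seminorm w m g f)%E.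
Proof.
apply: le_ereal_sup_tmp; eexists; first by exists ([ffun=> 0%N], 0).
by rewrite mule_ge0 ?expeR_ge0// lee_fin mulr_ge0 ?normc_ge0.
Qed.

Lemma q_seminorm0 m g : q_seminorm w m g (0 : V) = 0%E.
Proof.
apply/eqP; rewrite eq_le q_seminorm_ge0 andbT.
by apply: ge_ereal_sup => _ [p _ <-]; rewrite mpartial0 normc0 mulr0 mul0e.
Qed.

Lemma young_conj_ge0 (s : R) : 0 <= s -> (0 <= young_conj w s)%E.
Proof.
move=> s0; apply: le_ereal_sup_tmp; exists 0%E => //.
exists 0; first by rewrite /= in_itv/= lexx.
by rewrite mulr0 expR0 weight_normalized ?ler01 ?lexx// subrr.
Qed.

Lemma young_weight_ge0 m (alpha : multi_index N) : (0 <= young_weight w m alpha)%E.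
Proof.
by rewrite mule_ge0 ?lee_fin// young_conj_ge0// mulr_ge0// invr_ge0.
Qed.

(** Where the Young weight is infinite both sides are 0; nonnegativity excludes the value -oo. *)
Lemma expeR_weight (a : R) m (alpha : multi_index N) :
  expeR (- a%:E - young_weight w m alpha) =
  ((expR (- a))%:E * expeR (- young_weight w m alpha))%E.
Proof.
have := young_weight_ge0 m alpha; case: young_weight => [y| |] //= _.
  by rewrite -EFinM -expRD.
by rewrite mule0.
Qed.

(** Pointwise |g| <= C exp (- n w) trades [g] for the weight of the normed step; the continuity of
    the inclusion rests on this estimate. *)
Lemma q_seminorm_le_O_norm m n g C (f : V) :
    (forall x, expR (n%:R * weight_at w x) * normc (g x) <= C) ->
  (q_seminorm w m g f <= C%:E * O_norm w m n f)%E.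
Proof.
move=> gC; apply: ge_ereal_sup => _ [p _ <-].
have C0 : 0 <= C.
  by apply: le_trans (gC 0); rewrite mulr_ge0 ?normc_ge0 ?expR_ge0.
apply: (@le_trans _ _ (C%:E * ((normc (mpartial p.1 f p.2))%:E *
  expeR (- (n%:R * weight_at w p.2)%:E - young_weight w m p.1)))%E); last first.
  apply: lee_wpmul2l; rewrite ?lee_fin//.
  by apply: ereal_sup_ubound; exists p.
rewrite expeR_weight !muleA lee_wpmul2r ?expeR_ge0//.
rewrite -!EFinM lee_fin mulrAC ler_wpM2r ?normc_ge0//.
by rewrite expRN ler_pdivlMr ?expR_gt0// mulrC.
Qed.

Lemma S_omega_weighted (g : V) : S_omega w g -> forall n : nat, (0 < n)%N ->
  exists2 C, 0 < C & forall x, expR (n%:R * weight_at w x) * normc (g x) <= C.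
Proof.
move=> [_ _ wg _] n n0.
have [|C HC] := wg n%:R [ffun=> 0%N]; first by rewrite ltr0n.
(* Strict positivity is arranged because radii are later divided by this constant. *)
exists (`|C| + 1); first by rewrite ltr_pwDr.
move=> x; have := HC x; rewrite /mpartial /mpartialR.
have -> : flatten [seq nseq ([ffun=> 0%N] i : nat) i | i <- enum 'I_N] = [::].
  by elim: (enum _) => //= i s ->; rewrite ffunE.
have -> : (complex.Complex (complex.Re (g x)) (complex.Im (g x))) = g x by case: (g x).
by move/le_trans; apply; rewrite (le_trans (ler_norm _))// lerDl.
Qed.

Lemma smooth_O_union m (f : O_unionType N w m) : smooth (val f).
Proof. by have /set_mem[n _ []] := O_union_valP f. Qed.

Lemma smooth_O_M (f : O_MType N w) : smooth (val f).
Proof. by have /set_mem/(_ 1%N isT)[n _ []] := O_M_valP f. Qed.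

(** Absolute convexity is that of a seminorm ball; in the n-th normed step a ball of radius e / C
    fits inside, [C] depending on [n]. *)
Lemma q_ball_inductive m g (e : R) : (0 < m)%N -> S_omega w g -> 0 < e ->
  @inductive_nbhs0 R N w m [set f | (q_seminorm w m g (val f) < e%:E)%E].
Proof.
move=> m0 Sg e0; split.
  move=> a b x y ab /= qx qy.
  have [sx sy] := (smooth_O_union x, smooth_O_union y).
  pose M := maxe (q_seminorm w m g (val x)) (q_seminorm w m g (val y)).
  have M0 : (0 <= M)%E by rewrite le_max q_seminorm_ge0.
  apply: (@le_lt_trans _ _ M); last by rewrite gt_max qx.
  apply: le_trans (q_seminorm_lin m g a sx _) _.
    by rewrite -[_ b _]addr0; exact/smooth_lin/smooth0.
  apply: (@le_trans _ _ ((normc a)%:E * M + (normc b)%:E * M)%E).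
    apply: leeD; first by rewrite lee_wpmul2l ?lee_fin ?normc_ge0// le_max lexx.
    rewrite -[X in q_seminorm _ _ _ X]addr0.
    apply: le_trans (q_seminorm_lin m g b sy (@smooth0 _ _)) _.
    rewrite q_seminorm0 adde0 lee_wpmul2l ?lee_fin ?normc_ge0//.
    by rewrite le_max lexx orbT.
  rewrite -ge0_muleDl ?lee_fin ?normc_ge0// -EFinD -[leRHS]mul1e.
  by rewrite lee_wpmul2r// lee_fin -lecR rmorphD.
move=> n n0; have [C C0 gC] := S_omega_weighted Sg n0.
exists (e / C); first by rewrite divr_gt0.
move=> f _ fe /=; apply: le_lt_trans (q_seminorm_le_O_norm m _ gC) _.
by rewrite muleC -lte_pdivlMr.
Qed.

(** Triangle inequality: around [f] there is room for a ball of radius e - q(f - f0), a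
    neighbourhood of 0 in the inductive limit. *)
Lemma q_ball_open m (g : V) (f0 : O_unionType N w m) (e : R) :
  (0 < m)%N -> S_omega w g ->
  translation_open (@inductive_nbhs0 R N w m)
    [set f : O_unionType N w m | (q_seminorm w m g (val (f - f0)%R) < e%:E)%E].
Proof.
move=> m0 Sg f /= fe.
have q0 := q_seminorm_ge0 m g (val (f - f0)).
have qfin : q_seminorm w m g (val (f - f0)) \is a fin_num.
  by rewrite ge0_fin_numE// (lt_trans fe) ?ltry.
exists [set h : O_unionType N w m | (q_seminorm w m g (val h) <
    (e - fine (q_seminorm w m g (val (f - f0))))%:E)%E].
  by apply: q_ball_inductive => //; rewrite subr_gt0 -lte_fin fineK.
move=> h /= he; rewrite addrAC -(scale1r (val f - val f0)).
apply: le_lt_trans (q_seminorm_lin m g _ (smooth_O_union (f - f0)) (smooth_O_union h)) _.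
by rewrite normc1 mul1e addeC -(fineK qfin) -lteBrDr// -EFinB.
Qed.

Lemma q_ball_nbhs m (g : V) (f0 : O_MType N w) (e : R) :
  (0 < m)%N -> S_omega w g -> 0 < e ->
  nbhs (f0 : O_M_t N w)
    [set f | (q_seminorm w m g (val (f - f0)%R) < e%:E)%E].
Proof.
(* Index [m] of the projective family stands for the union with parameter m + 1. *)
case: m => // m _ Sg e0.
have /cvg_sup/(_ m) : nbhs (f0 : O_M_t N w) --> (f0 : O_M_t N w) by [].
apply.
have /(_ f0) := @initial_continuous _ _ (@O_M_incl R N w m).
move=> /(_ [set f | (q_seminorm w m.+1 g (val (f - O_M_incl m f0)%R) < e%:E)%E]).
apply; apply: open_nbhs_nbhs; split; first exact: (@q_ball_open m.+1 g (O_M_incl m f0) e).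
by rewrite /= subrr q_seminorm0 lte_fin.
Qed.

(** A tau-neighbourhood contains a finite intersection of seminorm balls, each of which is a
    t-neighbourhood. *)
Lemma continuous_t_tau : continuous (id : O_M_t N w -> O_M_tau N w).
Proof.
apply/continuousP => A Aopen; rewrite openE => f0 /= Af0.
have [W [s [e [sP e0 sW]]] WA] := Aopen f0 Af0.
have : nbhs (f0 : O_M_t N w) [set f | forall p, p \in s ->
    (q_seminorm w p.1 p.2 (val (f - f0)%R) < e%:E)%E].
  elim: s sP {sW} => [sP|p s IHs sP]; first exact: filterE.
  have [p0 Sp] := sP p (mem_head _ _).
  have {}IHs := IHs (fun q qs => sP q (@mem_behead _ (p :: s) _ qs)).
  apply: filterS2 (q_ball_nbhs f0 p0 Sp e0) IHs => f /= fp fs q.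
  by rewrite inE => /predU1P[->//|]; exact: fs.
by apply: filterS => f /sW/WA; rewrite addrC subrK.
Qed.

Lemma val_O_MZ (c : R[i]) (f : O_MType N w) : val (c *: f) = c *: val f.
Proof. by []. Qed.

Lemma q_ball_tau_open m (g : V) : (0 < m)%N -> S_omega w g ->
  translation_open (@tau_nbhs0 R N w)
    [set f : O_MType N w | (q_seminorm w m g (val f) < 1%:E)%E].
Proof.
move=> m0 Sg f /= f1; have q0 := q_seminorm_ge0 m g (val f).
have qfin : q_seminorm w m g (val f) \is a fin_num.
  by rewrite ge0_fin_numE// (lt_trans f1) ?ltry.
exists [set h : O_MType N w | (q_seminorm w m g (val h) <
    (1 - fine (q_seminorm w m g (val f)))%:E)%E].
  exists [:: (m, g)], (1 - fine (q_seminorm w m g (val f))); split.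
  - by move=> p; rewrite inE => /eqP ->.
  - by rewrite subr_gt0 -lte_fin fineK.
  - by move=> h /(_ _ (mem_head _ _)).
move=> h /= he; rewrite -(scale1r (O_M_val f)).
apply: le_lt_trans (q_seminorm_lin m g _ (smooth_O_M f) (smooth_O_M h)) _.
by rewrite normc1 mul1e addeC -(fineK qfin) -lteBrDr// -EFinB.
Qed.

Lemma q_ball_tau_nbhs m (g : V) : (0 < m)%N -> S_omega w g ->
  nbhs (0 : O_M_tau N w)
    [set f : O_MType N w | (q_seminorm w m g (val f) < 1%:E)%E].
Proof.
move=> m0 Sg; apply: open_nbhs_nbhs; split; first exact: q_ball_tau_open.
by rewrite /= q_seminorm0 lte_fin.
Qed.

Lemma tau_bounded_q (B : set (O_MType N w)) m (g : V) :
    @vn_bounded _ (O_M_tau N w) B -> (0 < m)%N -> S_omega w g ->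
  exists C : R, forall f, B f -> (q_seminorm w m g (val f) <= C%:E)%E.
Proof.
move=> bB m0 Sg.
have [r r0 Br] := bB _ (q_ball_tau_nbhs m0 Sg).
exists (normc r) => f Bf.
(* Absorption by the unit ball is applied with the scalar [r] itself, so its modulus bounds the
   seminorm on [B]. *)
have rr : r <= `|r| by rewrite gtr0_norm.
have [u u1 uf] := Br r rr f Bf.
have -> : val f = r *: val (u : O_MType N w) by rewrite -uf.
rewrite -[_ *: _]addr0.
apply: le_trans (q_seminorm_lin m g r (smooth_O_M u) (@smooth0 _ _)) _.
by rewrite q_seminorm0 adde0 -[leRHS]mule1 lee_wpmul2l ?lee_fin ?normc_ge0// ltW.
Qed.

Lemma tau_bounded_O_norm (hN : (0 < N)%N) (B : set (O_MType N w)) m :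
    @vn_bounded _ (O_M_tau N w) B -> (0 < m)%N ->
  exists2 n, (0 < n)%N & exists C : R, forall f, B f ->
    (O_norm w m n (val f) <= C%:E)%E.
Proof.
move=> bB m0; apply: contrapT => nB.
have /choice[x xP] k : exists x : 'rV[R]_N, exists2 f, B f & exists alpha,
   (((4 ^+ (N * k.+1))%:E < (normc (mpartial alpha (val f) x))%:E *
     expeR (- ((N * k.+1)%:R * weight_at w x)%:E - young_weight w m alpha)))%E.
  (* If no such point existed for [k], the norm with n = N (k + 1) would be bounded by 4^n on [B].
     The shift by one keeps n positive at k = 0. *)
  apply: contrapT => nx; apply: nB; exists (N * k.+1)%N.
    by rewrite muln_gt0 hN.
  exists (4 ^+ (N * k.+1)) => f Bf; apply: ge_ereal_sup => _ [[alpha x] _ <-] /=.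
  by rewrite leNgt; apply/negP => h; apply: nx; exists x, f => //; exists alpha.
(* The point [x k] must meet the minorant of index k + 1; in the shifted sequence [x 0] occurs
   twice. *)
have [g Sg gx] := S_omega_minorant w (fun k => x k.-1).
have [C HC] := tau_bounded_q bB m0 Sg.
have [k Ck] : exists k, C < 2 ^+ k.
  exists (Num.truncn C).+1; apply: (lt_trans (truncnS_gt C)).
  by rewrite -natrX ltr_nat ltn_expl.
have [f Bf [alpha]] := xP k; apply/negP; rewrite -leNgt.
have qC : ((normc (g (x k)) * normc (mpartial alpha (val f) (x k)))%:E *
    expeR (- young_weight w m alpha) <= C%:E)%E.
  by apply: le_trans (HC f Bf); apply: ereal_sup_ubound; exists (alpha, x k).
rewrite expeR_weight; set E := expeR _ in qC *.
have E0 : (0 <= E)%E by exact: expeR_ge0.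
set X := normc (mpartial _ _ _) in qC *; set n := (N * k.+1)%N.
(* Since exp (- n w) <= 2^n |g|, the quantity assumed to exceed 4^n is at most 2^n C <= 2^n 2^k <=
   4^n, as k <= n. *)
apply: (@le_trans _ _ ((2 ^+ n)%:E * ((normc (g (x k)) * X)%:E * E))%E).
  rewrite !muleA lee_wpmul2r// -!EFinM lee_fin mulrA [leLHS]mulrC ler_wpM2r ?normc_ge0//.
  by have := gx k.+1; rewrite ler_pdivrMr ?exprn_gt0// [leRHS]mulrC.
apply: (@le_trans _ _ ((2 ^+ n)%:E * (2 ^+ k)%:E)%E).
  by rewrite lee_wpmul2l ?lee_fin ?exprn_ge0// (le_trans qC)// lee_fin ltW.
have -> : 4 ^+ n = 2 ^+ n * 2 ^+ n :> R by rewrite -exprMn -natrM.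
rewrite -EFinM lee_fin.
rewrite ler_pM2l ?exprn_gt0// ler_weXn2l ?ler1n//.
by rewrite (leq_trans (leqnSn k))// leq_pmull.
Qed.

(** The sets absorbing [B] form a filter, so boundedness says that this filter converges to 0, which
    can be checked in each member of the projective family. *)
Lemma t_bounded (B : set (O_MType N w)) :
    (forall m, (0 < m)%N -> exists2 n, (0 < n)%N & exists C : R, forall f, B f ->
      (O_norm w m n (val f) <= C%:E)%E) ->
  @vn_bounded _ (O_M_t N w) B.
Proof.
move=> bB U.
pose F : set_system (O_M_t N w) := [set A | exists2 r : R[i], 0 < r &
  forall c, r <= `|c| -> B `<=` [set c *: u | u in A]].
have FF : Filter F.
  split; first exists 1 => // c c1 f _.
  - have c0 : c != 0 by rewrite -normr_gt0 (lt_le_trans _ c1).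
    by exists (c^-1 *: f) => //; rewrite scalerA divff// scale1r.
  - move=> P Q [r r0 rP] [r' r'0 r'Q]; exists (r + r'); first exact: addr_gt0.
    move=> c cr f Bf.
    have rc : r <= `|c| by rewrite (le_trans _ cr)// lerDl ltW.
    have r'c : r' <= `|c| by rewrite (le_trans _ cr)// lerDr ltW.
    have c0 : c != 0 by rewrite -normr_gt0 (lt_le_trans _ rc).
    (* Both preimages of [f] under scaling by the nonzero [c] coincide, so the common one lies in
       the intersection. *)
    have [u Pu uf] := rP c rc f Bf; have [v Qv vf] := r'Q c r'c f Bf.
    exists u => //; split => //; suff -> : u = v by [].
    by apply: (scalerI c0); rewrite uf vf.
  - move=> P Q PQ [r r0 rP]; exists r => // c cr f /(rP c cr)[u Pu uf].
    by exists u => //; exact: PQ.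
suff : F --> (0 : O_M_t N w) by apply.
apply/cvg_sup => m A.
move=> [_ [[W oW <-] /= W0 WA]].
apply: (filterS WA) => {A WA}.
have [D [aD nD] DW] := oW _ W0.
have [n n0 [C HC]] := bB m.+1 isT.
have [d d0 Dd] := nD n n0.
have WD (h : O_MType N w) : (O_norm w m.+1 n (val h) < d%:E)%E -> W (O_M_incl m h).
  move=> hd; rewrite -[X in W X]add0r.
  have -> : 0 = O_M_incl m 0 :> O_unionType N w m.+1 by exact: val_inj.
  apply: DW; apply: (Dd (O_M_incl m h)); last exact: hd.
  by split; [exact: smooth_O_M|exact: lt_trans hd (ltry _)].
(* Dividing by a scalar of at least this modulus brings the norm bound [C] strictly below [d]; the
   added 1 gives strictness and positivity. *)
exists (((`|C| + 1) / d)%:C)%C.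
  by rewrite ltcR divr_gt0// ltr_pwDr.
move=> c cr f Bf.
have c0 : c != 0.
  by rewrite -normr_gt0 (lt_le_trans _ cr)// ltcR divr_gt0// ltr_pwDr.
exists (c^-1 *: f); last by rewrite scalerA divff// scale1r.
have cfd : (O_norm w m.+1 n (val (c^-1 *: f)) < d%:E)%E.
  rewrite val_O_MZ -[_ *: _]addr0.
  apply: le_lt_trans (O_norm_lin w m.+1 n _ (smooth_O_M f) (@smooth0 _ _)) _.
  rewrite O_norm0 adde0 (@le_lt_trans _ _ ((normc c^-1)%:E * C%:E)%E)//.
    by rewrite lee_wpmul2l ?lee_fin ?normc_ge0// HC.
  rewrite -EFinM lte_fin normcV mulrC ltr_pdivrMr.
    rewrite lecR ler_pdivrMr// in cr.
    by rewrite (le_lt_trans (ler_norm C))// mulrC (lt_le_trans _ cr)// ltrDl.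
  by rewrite lt_neqAle normc_ge0 andbT eq_sym; apply: contra_neq c0; exact: eq0_normc.
exact: WD cfd.
Qed.

End topologies.

Theorem proposition5p6 (R : realType) (N : nat) (hN : (0 < N)%N)
    (w : nqa_weight R) :
  continuous (id : O_M_t N w -> O_M_tau N w) /\
  forall B : set (O_MType N w),
    @vn_bounded _ (O_M_t N w) B <-> @vn_bounded _ (O_M_tau N w) B.
Proof.
split; first exact: continuous_t_tau.
move=> B; split=> bB.
  (* Continuity at 0 makes every tau-neighbourhood of 0 a t-neighbourhood, which absorbs [B]. *)
  move=> U U0; have /(_ (0 : O_M_t N w) U U0) := @continuous_t_tau R N w; exact: bB.
by apply: t_bounded => m m0; exact: tau_bounded_O_norm.
Qed.
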